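(* Let $A$ be a Buchsbaum local ring with maximal ideal $\mathfrak{m}$ and $d = \dim A \geq 1$. Then there exists an integer $\ell \gg 0$ such that the index $\ell_A((Q : \mathfrak{m})/Q)$ of reducibility of $Q$ is independent of $Q$ and equals $\mathrm{r}(A)$ for all parameter ideals $Q \subseteq \mathfrak{m}^{\ell}$.
   Context: A parameter ideal in $A$ is an ideal generated by a system of parameters. A Noetherian local ring $A$ with maximal ideal $\mathfrak{m}$ and $d = \dim A\geq 1$ is a Buchsbaum ring if the difference $\ell_A(A/Q) - \mathrm{e}^0_Q(A)$ is independent of the choice of a parameter ideal $Q$, where $\mathrm{e}^0_Q(A)$ is the multiplicity of $A$ with respect to $Q$; equivalently, every system of parameters $x_1,\dots,x_d$ satisfies $(x_1,\dots,x_{i-1}):x_i = (x_1,\dots,x_{i-1}):\mathfrak{m}$ for all $1\leq i\leq d$. $\ell_A$ denotes length; $Q:\mathfrak{m} = \{x\in A \mid x\mathfrak{m}\subseteq Q\}$. The Cohen-Macaulay type of $A$ is $\mathrm{r}(A) = \sup_Q \ell_A((Q:\mathfrak{m})/Q)$, where $Q$ runs over the parameter ideals in $A$; it is finite for Buchsbaum $A$ (it equals $\sum_{i=0}^{d-1}\binom{d}{i}\ell_A(\mathrm{H}^i_{\mathfrak{m}}(A)) + \mu_{\widehat{A}}(\mathrm{K}_{\widehat{A}})$, with $\mathrm{K}_{\widehat{A}}$ the canonical module of the completion $\widehat{A}$ and $\mu$ the minimal number of generators). *)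

(* Defs.v *)
From mathcomp Require Import all_boot all_order all_algebra.
From mathcomp Require Import boolp classical_sets constructive_ereal.

Set Implicit Arguments.
Unset Strict Implicit.
Unset Printing Implicit Defensive.

Import Order.TTheory GRing.Theory Num.Theory.

Local Open Scope classical_set_scope.
Local Open Scope ring_scope.

(* Ideals are classical subsets ([set A]) of a commutative ring [A].
   Lengths, Krull dimensions and their suprema live in [\bar int]. *)

Section Ideals.
Variable A : comNzRingType.
Implicit Types (I J P Q m : set A).

Definition is_ideal I : Prop :=
  [/\ I 0, forall x y, I x -> I y -> I (x + y) & forall a x, I x -> I (a * x)].

Definition ideal_gen (S : set A) : set A := smallest is_ideal S.

Definition ideal_mul I J : set A := ideal_gen [set x * y | x in I & y in J].

(* I^0 = A *)
Definition ideal_pow I (n : nat) : set A := iter n (ideal_mul I) setT.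

(* I : J *)
Definition ideal_colon I J : set A := [set x | forall y, J y -> I (x * y)].

Definition is_prime P : Prop :=
  [/\ is_ideal P, P <> setT & forall x y, P (x * y) -> P x \/ P y].

Definition is_maximal m : Prop :=
  [/\ is_ideal m, m <> setT &
      forall J, is_ideal J -> m `<=` J -> J = m \/ J = setT].

Definition is_local_ring m : Prop :=
  is_maximal m /\ forall m', is_maximal m' -> m' = m.

(* Supremum of the n such that C contains a chain K_0 < K_1 < ... < K_n. *)
Definition chain_sup (C : set (set A)) : \bar int :=
  supremum 0%E [set (n%:Z)%:E | n in [set n : nat |
    exists K : nat -> set A,
      (forall i, (i <= n)%N -> C (K i)) /\
      (forall i, (i < n)%N -> K i `<` K i.+1)]].

(* The length of the A-module J / I, for ideals I `<=` J: the submodules of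
   J / I are the K / I with K an ideal such that I `<=` K `<=` J. *)
Definition quot_length J I : \bar int :=
  chain_sup [set K | [/\ is_ideal K, I `<=` K & K `<=` J]].

(* d stands for the Krull dimension of A and m for its maximal ideal. *)

(* x_1, ..., x_d in m generating an m-primary ideal *)
Definition is_sop m (d : nat) (x : 'I_d -> A) : Prop :=
  (forall i, m (x i)) /\ exists n, ideal_pow m n `<=` ideal_gen (range x).

Definition is_parameter_ideal m (d : nat) Q : Prop :=
  exists x : 'I_d -> A, is_sop m x /\ Q = ideal_gen (range x).

(* c_0, ..., c_d are the Hilbert coefficients of Q: for n >> 0,
   l(A / Q^(n+1)) = sum_(0 <= i <= d) (-1)^i c_i 'C(n + d - i, d - i). *)
Definition is_hilbert_coef (d : nat) Q (c : 'I_d.+1 -> int) : Prop :=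
  exists n0 : nat, forall n : nat, (n0 <= n)%N ->
    quot_length setT (ideal_pow Q n.+1) =
      (\sum_(i < d.+1) (-1) ^+ i * c i * ('C(n + (d - i), d - i))%:Z)%:E.

(* e^0_Q(A) *)
Definition multiplicity (d : nat) Q : int :=
  xget 0 [set e | exists c : 'I_d.+1 -> int, is_hilbert_coef Q c /\ e = c ord0].

(* l(A / Q) - e^0_Q(A) does not depend on the parameter ideal Q *)
Definition is_buchsbaum m (d : nat) : Prop :=
  forall Q Q', is_parameter_ideal m d Q -> is_parameter_ideal m d Q' ->
    (quot_length setT Q - (multiplicity d Q)%:E)%E =
    (quot_length setT Q' - (multiplicity d Q')%:E)%E.

(* l((Q : m) / Q) *)
Definition reducibility_index m Q : \bar int :=
  quot_length (ideal_colon Q m) Q.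

Definition cm_type m (d : nat) : \bar int :=
  supremum 0%E
    [set reducibility_index m Q | Q in [set Q | is_parameter_ideal m d Q]].

End Ideals.

Definition is_noetherian (A : comNzRingType) : Prop :=
  forall I : set A, is_ideal I ->
    exists n (x : 'I_n -> A), I = ideal_gen (range x).

Definition krull_dim (A : comNzRingType) : \bar int :=
  chain_sup (@is_prime A).

(* Main.v *)
(* The proof is elementary, without local cohomology.  Let w be a system of
   parameters, J = (w_k, k != i) and x = w_i.

   Comparing Hilbert-Samuel polynomials, e(w^k) = k^d e(w).  Since l(A/(w)) - e(w)
   is constant and the length is subadditive, this forces e to be multiplicative in
   each w_i separately, so l(A/((x^n) + J)) is affine in n >= 1.  Hence J : x^n =
   J : x = J : m, and Krull's intersection theorem extends this to (w_k, k in P) : w_i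
   = (w_k, k in P) : m whenever i is not in P.

   Put U(w) = (w) + sum_i ((w_k, k != i) : m), an ideal between (w) and (w) : m.
   Multiplication by y gives an isomorphism of subquotients showing that l(U(w)/(w))
   does not change when x is replaced by x y, hence by y; as any two systems of
   parameters are connected by such replacements, it is a constant.  If z = a w
   for a square matrix a, multiplication by det a maps (w) : m into (z) : m and is
   injective modulo U(w) and U(z).  So the index of reducibility does not decrease
   when the parameter ideal shrinks.  It takes the same value on all the (w^n) with
   n >= 2, and every parameter ideal contains such an ideal; so its maximum is
   attained at (w^2), and at every parameter ideal inside (w^2). *)

Require Import Defs.
From mathcomp Require Import all_boot all_order all_algebra.
From mathcomp Require Import boolp classical_sets constructive_ereal.
From mathcomp Require Import zify ring.

Set Implicit Arguments.
Unset Strict Implicit.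
Unset Printing Implicit Defensive.

Import Order.TTheory GRing.Theory Num.Theory.

Local Open Scope classical_set_scope.
Local Open Scope ring_scope.

(** * Ideals and lengths *)

(** The multiplicity is chosen among Hilbert coefficients with default 0, so statements about e need
    the existence of the Hilbert polynomial. It comes from a Groebner-type filtration of Q^n /
    Q^(n+1), whose factors have lengths that are antitone in the exponent vector. Passing from J : x
    to J : m is delicate because an arbitrary p in m need not be a parameter modulo J; but p + x^M
    is one for large M, and it acts on (J : x)/J as p does. The same perturbation gives two systems
    a common replacement for one entry, hence connectedness. The determinant map need not be
    injective on ((w) : m)/(w), since prod w maps U(w) into (w^2). Hence the splitting of the index
    as l(((w) : m)/U(w)) + l(U(w)/(w)): the first term does not decrease when the ideal shrinks, the
    second is constant. The exponent 2 arises because, modulo J : m, an element of ((x^n) + J) : m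
    has the form x^(n-1) f, that is x^(n-2) times an element x f of ((x^2) + J) : m. *)

Section IdealBasics.
Variable A : comNzRingType.
Implicit Types (I J K L : set A) (x y z a b c : A).

Lemma ideal0 I : is_ideal I -> I 0. Proof. by case. Qed.

Lemma idealD I x y : is_ideal I -> I x -> I y -> I (x + y).
Proof. by case=> _ + _; apply. Qed.

Lemma idealM I a x : is_ideal I -> I x -> I (a * x).
Proof. by case=> _ _; apply. Qed.

Lemma idealMr I a x : is_ideal I -> I x -> I (x * a).
Proof. by move=> iI Ix; rewrite mulrC; apply: idealM. Qed.

Lemma idealN I x : is_ideal I -> I x -> I (- x).
Proof. by move=> iI Ix; rewrite -mulN1r; apply: idealM. Qed.

Lemma idealB I x y : is_ideal I -> I x -> I y -> I (x - y).
Proof. by move=> iI Ix Iy; apply: idealD => //; apply: idealN. Qed.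

Lemma ideal_congr I x y : I x -> x = y -> I y.
Proof. by move=> Ix <-. Qed.

Lemma ideal_sum I (T : Type) (r : seq T) (P : pred T) (F : T -> A) :
  is_ideal I -> (forall i, P i -> I (F i)) -> I (\sum_(i <- r | P i) F i).
Proof.
move=> iI hF; elim/big_ind : _ => //; first exact: ideal0.
by move=> x y; apply: idealD.
Qed.

Lemma is_idealT : is_ideal [set: A]. Proof. by split. Qed.

Lemma is_ideal_setI I J : is_ideal I -> is_ideal J -> is_ideal (I `&` J).
Proof.
move=> iI iJ; split; first by split; apply: ideal0.
- by move=> x y [? ?] [? ?]; split; apply: idealD.
- by move=> a x [? ?]; split; apply: idealM.
Qed.

Lemma ideal_gen_ideal (S : set A) : is_ideal (ideal_gen S).
Proof.
split.
- by move=> I [iI _]; apply: ideal0.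
- move=> x y hx hy I [iI SI].
  by apply: idealD => //; [apply: hx|apply: hy].
- move=> a x hx I [iI SI]; apply: idealM => //; exact: hx.
Qed.

Lemma sub_ideal_gen (S : set A) : S `<=` ideal_gen S.
Proof. exact: sub_gen_smallest. Qed.

Lemma ideal_gen_sub (S : set A) I : is_ideal I -> S `<=` I -> ideal_gen S `<=` I.
Proof. exact: smallest_sub. Qed.

(** This is the ideal [x I + J]. With [x = 1] it is the sum of two ideals, with [I = setT] the ideal
    [(x) + J]; one form covers sums, adjunction of a generator and images under multiplication. *)
Definition lin x I J : set A := [set z | exists2 a, I a & J (z - x * a)].

Definition adj x J : set A := lin x setT J.

Definition quo J x : set A := [set a | J (x * a)].

Lemma lin_ideal x I J : is_ideal I -> is_ideal J -> is_ideal (lin x I J).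
Proof.
move=> iI iJ; split.
- exists 0; first exact: ideal0.
  by rewrite mulr0 subr0; apply: ideal0.
- move=> y z [a Ia Ja] [b Ib Jb]; exists (a + b); first exact: idealD.
  by apply: (ideal_congr (idealD iJ Ja Jb)); ring.
- move=> c y [a Ia Ja]; exists (c * a); first exact: idealM.
  by apply: (ideal_congr (idealM c iJ Ja)); ring.
Qed.

Lemma adj_ideal x J : is_ideal J -> is_ideal (adj x J).
Proof. by apply: lin_ideal; apply: is_idealT. Qed.

Lemma quo_ideal x J : is_ideal J -> is_ideal (quo J x).
Proof.
move=> iJ; split; rewrite /quo /=.
- by rewrite mulr0; apply: ideal0.
- by move=> a b; rewrite mulrDr; apply: idealD.
- by move=> c a Ja; apply: (ideal_congr (idealM c iJ Ja)); ring.
Qed.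

Lemma colon_ideal I J : is_ideal I -> is_ideal (ideal_colon I J).
Proof.
move=> iI; split; rewrite /ideal_colon /=.
- by move=> y _; rewrite mul0r; apply: ideal0.
- by move=> a b ha hb y Jy; rewrite mulrDl; apply: idealD; [|exact: ha|exact: hb].
- by move=> c a ha y Jy; rewrite -mulrA; apply: idealM; [|exact: ha].
Qed.

Lemma sub_colon I J : is_ideal I -> I `<=` ideal_colon I J.
Proof. by move=> iI x Ix y _; apply: idealMr. Qed.

Lemma colonS I I' J : I `<=` I' -> ideal_colon I J `<=` ideal_colon I' J.
Proof. by move=> II' x hx y /hx /II'. Qed.

Lemma sub_quo J x : is_ideal J -> J `<=` quo J x.
Proof. by move=> iJ a Ja; apply: idealM. Qed.

Lemma sub_linr x I J : is_ideal I -> J `<=` lin x I J.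
Proof. by move=> iI z Jz; exists 0; [exact: ideal0|rewrite mulr0 subr0]. Qed.

Lemma sub_adj x J : J `<=` adj x J.
Proof. by apply: sub_linr; apply: is_idealT. Qed.

Lemma lin_mul x I J a : is_ideal J -> I a -> lin x I J (x * a).
Proof. by move=> iJ Ia; exists a => //; rewrite subrr; apply: ideal0. Qed.

Lemma adj_mul x J a : is_ideal J -> adj x J (x * a).
Proof. by move=> iJ; apply: lin_mul. Qed.

Lemma adj_id x J : is_ideal J -> adj x J x.
Proof. by move=> iJ; exists 1 => //; rewrite mulr1 subrr; apply: ideal0. Qed.

Lemma adj_sub x J K : is_ideal K -> K x -> J `<=` K -> adj x J `<=` K.
Proof.
move=> iK Kx JK z [a _ /JK Kz].
by apply: (ideal_congr (idealD iK Kz (idealMr a iK Kx))); ring.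
Qed.

Lemma lin_sub x I J K : is_ideal K -> (forall a, I a -> K (x * a)) -> J `<=` K ->
  lin x I J `<=` K.
Proof.
move=> iK Kx JK z [a Ia /JK Kz].
by apply: (ideal_congr (idealD iK Kz (Kx _ Ia))); ring.
Qed.

Lemma linS x I I' J J' : I `<=` I' -> J `<=` J' -> lin x I J `<=` lin x I' J'.
Proof. by move=> II' JJ' z [a /II' ? /JJ' ?]; exists a. Qed.

Lemma adjS x J J' : J `<=` J' -> adj x J `<=` adj x J'.
Proof. by apply: linS. Qed.

End IdealBasics.

(** * Lengths of quotients through chains of intermediate ideals *)

Section Length.
Variable A : comNzRingType.
Implicit Types (I J K L : set A) (x y z a b c : A).

Definition ideal_between J I : set (set A) :=
  [set K | [/\ is_ideal K, I `<=` K & K `<=` J]].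

Definition has_chain J I n := exists K : nat -> set A,
  (forall i, (i <= n)%N -> ideal_between J I (K i)) /\
  (forall i, (i < n)%N -> K i `<` K i.+1).

Definition finl J I := exists n, forall k, has_chain J I k -> (k <= n)%N.

(** The value is 0 by default when chains are unbounded, so additivity and comparison are stated
    under [finl]; [quot_length_finl] links this number to the supremum in [\bar int]. *)
Definition len J I : nat :=
  xget 0%N [set n | has_chain J I n /\ forall k, has_chain J I k -> (k <= n)%N].

Lemma has_chainS J I J' I' n : I' `<=` I -> J `<=` J' -> has_chain J I n -> has_chain J' I' n.
Proof.
move=> I'I JJ' [K [hK hlt]]; exists K; split=> // i /hK [iK IK KJ].
by split=> //; [apply: subset_trans IK|apply: subset_trans JJ'].
Qed.

Lemma has_chain0 J I : is_ideal I -> I `<=` J -> has_chain J I 0.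
Proof. by move=> iI IJ; exists (fun=> I); split=> // i _; split. Qed.

Lemma has_chain_ext J I J' n : has_chain J I n -> is_ideal J' -> I `<=` J' -> J `<` J' ->
  has_chain J' I n.+1.
Proof.
move=> [K [hK hlt]] iJ' IJ' [JJ' nJ'].
exists (fun i => if (i <= n)%N then K i else J'); split=> [i _|i].
  case: ifP => [/hK[iK IK KJ]|_]; last by split.
  by split=> //; apply: subset_trans JJ'.
case: (ltngtP i n) => [ltin _||-> _]; [exact: hlt|by rewrite ltnS; case: ltngtP|].
have [_ _ KJ] := hK n (leqnn n).
split; first exact: subset_trans JJ'.
by move=> J'K; apply: nJ'; apply: subset_trans KJ.
Qed.

Lemma has_chain1 J I : is_ideal I -> is_ideal J -> I `<` J -> has_chain J I 1.
Proof.
move=> iI iJ IJ; apply: (has_chain_ext (has_chain0 iI (fun z => id))) => //; exact: (proj1 IJ).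
Qed.

Lemma has_chain_cat J K I n p : I `<=` K -> has_chain J K n -> has_chain K I p ->
  has_chain J I (p + n).
Proof.
move=> IK [G [hG Glt]] cKI.
have H i : (i <= n)%N -> has_chain (G i) I (p + i).
  elim: i => [|i IHi] lein.
    by rewrite addn0; apply: has_chainS cKI => //; case: (hG 0%N lein).
  rewrite addnS; have [iG KG _] := hG _ lein.
  apply: has_chain_ext (IHi (ltnW lein)) _ _ (Glt _ lein) => //.
  exact: subset_trans KG.
have [iG _ GJ] := hG n (leqnn n).
exact: has_chainS GJ (H n (leqnn n)).
Qed.

Lemma proper_dec I J : I `<=` J -> I `<` J \/ J `<=` I.
Proof. by move=> IJ; case: (pselect (J `<=` I)); [right|left]. Qed.

(* By the modular law, F < F' forces F + K < F' + K or F & K < F' & K. *)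
Lemma has_chain_split J K I n : is_ideal I -> is_ideal K -> I `<=` K -> K `<=` J ->
  is_ideal J -> has_chain J I n ->
  exists p q, [/\ (n <= q + p)%N, has_chain J K p & has_chain K I q].
Proof.
move=> iI iK IK KJ iJ [F [hF Flt]].
have H i : (i <= n)%N -> exists p q,
    [/\ (i <= q + p)%N, has_chain (lin 1 (F i) K) K p & has_chain (F i `&` K) I q].
  elim: i => [|i IHi] lein.
    have [iF IF FJ] := hF _ lein.
    exists 0%N, 0%N; split=> //; apply: has_chain0 => //; first exact: sub_linr.
    by move=> z Iz; split; [apply: IF|apply: IK].
  have [p [q [le cp cq]]] := IHi (ltnW lein).
  have [iF IF FJ] := hF _ (ltnW lein).
  have [iF' IF' FJ'] := hF _ lein.
  have [FF nFF] := Flt _ lein.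
  have s1 : lin 1 (F i) K `<=` lin 1 (F i.+1) K by apply: linS.
  have s2 : F i `&` K `<=` F i.+1 `&` K by apply: setSI.
  have IFK : I `<=` F i.+1 `&` K by move=> z Iz; split; [apply: IF'|apply: IK].
  have [h1|h1] := proper_dec s1.
    exists p.+1, q; split; first by rewrite addnS.
    + apply: has_chain_ext cp _ _ h1; first exact: lin_ideal.
      exact: sub_linr.
    + exact: has_chainS cq.
  have [h2|h2] := proper_dec s2.
    exists p, q.+1; split; first by rewrite addSn.
    + exact: has_chainS cp.
    + by apply: has_chain_ext cq _ _ h2 => //; apply: is_ideal_setI.
  exfalso; apply: nFF => z Fz.
  have [|a Fa Ka] := h1 z; first by exists z => //; rewrite mul1r subrr; apply: ideal0.
  have /h2[Fb _] : (F i.+1 `&` K) (z - 1 * a).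
    by split=> //; apply: idealB => //; rewrite mul1r; apply: FF.
  by apply: (ideal_congr (idealD iF Fb Fa)); ring.
have [p [q [le cp cq]]] := H n (leqnn n).
have [iF IF FJ] := hF n (leqnn n).
exists p, q; split=> //; last by apply: has_chainS cq => // z [].
apply: has_chainS cp => //; apply: lin_sub => // a Fa; rewrite mul1r; exact: FJ.
Qed.

Lemma lenP J I : is_ideal I -> I `<=` J -> finl J I ->
  has_chain J I (len J I) /\ forall k, has_chain J I k -> (k <= len J I)%N.
Proof.
move=> iI IJ [n hn].
pose S := [set n | has_chain J I n /\ forall k, has_chain J I k -> (k <= n)%N].
suff /(xgetPex 0%N) : exists n, S n by [].
have ex : exists k, `[< has_chain J I k >] by exists 0%N; apply: asboolT; apply: has_chain0.
have bd k : `[< has_chain J I k >] -> (k <= n)%N by move/asboolW; apply: hn.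
have [k /asboolW hk hmax] := ex_maxnP ex bd.
by exists k; split=> // j cj; apply: hmax; apply: asboolT.
Qed.

Lemma finlS J I J' I' : I' `<=` I -> J `<=` J' -> finl J' I' -> finl J I.
Proof. by move=> II JJ [n hn]; exists n => k ck; apply: hn; apply: has_chainS ck. Qed.

Lemma finl_add J K I : is_ideal I -> is_ideal K -> is_ideal J -> I `<=` K -> K `<=` J ->
  finl J K -> finl K I -> finl J I.
Proof.
move=> iI iK iJ IK KJ [n hn] [p hp]; exists (p + n)%N => k ck.
have [r [s [le cr cs]]] := has_chain_split iI iK IK KJ iJ ck.
by apply: leq_trans le _; apply: leq_add; [apply: hp|apply: hn].
Qed.

Lemma len_add J K I : is_ideal I -> is_ideal K -> is_ideal J -> I `<=` K -> K `<=` J ->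
  finl J I -> len J I = (len J K + len K I)%N.
Proof.
move=> iI iK iJ IK KJ fJI.
have fJK : finl J K by apply: finlS fJI.
have fKI : finl K I by apply: finlS fJI.
have IJ := subset_trans IK KJ.
have [c1 m1] := lenP iI IJ fJI.
have [c2 m2] := lenP iK KJ fJK.
have [c3 m3] := lenP iI IK fKI.
apply/eqP; rewrite eqn_leq addnC; apply/andP; split.
  have [r [s [le cr cs]]] := has_chain_split iI iK IK KJ iJ c1.
  by apply: leq_trans le _; apply: leq_add; [apply: m3|apply: m2].
by apply: m1; apply: has_chain_cat c2 c3.
Qed.

Lemma len_self I : is_ideal I -> len I I = 0%N.
Proof.
move=> iI; have f : finl I I.
  exists 0%N => k [F [hF Flt]]; rewrite leqNgt; apply/negP => k0.
  have [_ h] := Flt 0%N k0; apply: h.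
  have [_ h1 _] := hF 0%N isT; have [_ _ h2] := hF 1%N k0.
  exact: subset_trans h1.
have sII : I `<=` I by [].
by have := len_add iI iI iI sII sII f; lia.
Qed.

Lemma len_eq0 J I : is_ideal I -> is_ideal J -> I `<=` J -> finl J I ->
  len J I = 0%N -> J `<=` I.
Proof.
move=> iI iJ IJ fJI l0; case: (proper_dec IJ) => // pIJ.
have [_ /(_ 1%N (has_chain1 iI iJ pIJ))] := lenP iI IJ fJI.
by rewrite l0.
Qed.

Lemma len_chn_le J I J' I' : is_ideal I -> I `<=` J -> is_ideal I' -> I' `<=` J' ->
  finl J' I' -> (forall n, has_chain J I n -> has_chain J' I' n) -> (len J I <= len J' I')%N.
Proof.
move=> iI IJ iI' IJ' f' h.
have f : finl J I by case: f' => n hn; exists n => k /h /hn.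
have [c _] := lenP iI IJ f; have [_ m'] := lenP iI' IJ' f'.
by apply: m'; apply: h.
Qed.

Lemma len_sub J I J' I' : is_ideal I -> I `<=` J -> is_ideal I' ->
  I' `<=` I -> J `<=` J' -> finl J' I' -> (len J I <= len J' I')%N.
Proof.
move=> iI IJ iI' II JJ f; apply: len_chn_le => //.
  by apply: subset_trans JJ; apply: subset_trans IJ.
by move=> n; apply: has_chainS.
Qed.

(** The chain is carried over by [K |-> x K + I']. Strictness rests only on the fact that [x a] in
    [I'] forces [a] in [I]; [x I] may leave [I'], a freedom exploited in the comparison by
    determinants. *)
Lemma has_chain_mul x J I J' I' n : is_ideal J' -> is_ideal I' -> I' `<=` J' ->
  (forall a, J a -> J' (x * a)) -> (forall a, J a -> I' (x * a) -> I a) ->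
  has_chain J I n -> has_chain J' I' n.
Proof.
move=> iJ' iI' IJ' xJ inj [K [hK Klt]].
exists (fun i => lin x (K i) I'); split=> [i /hK[iK IK KJ]|i ltin].
  split; first exact: lin_ideal.
    exact: sub_linr.
  by apply: lin_sub => // a /KJ /xJ.
have [iK IK KJ] := hK _ (ltnW ltin); have [iK' IK' KJ'] := hK _ ltin.
have [KK nKK] := Klt _ ltin.
split; first exact: linS.
move=> h; apply: nKK => a Ka.
have [b Kb Ib] := h _ (lin_mul x iI' Ka).
have : I (a - b).
  apply: inj; last by apply: (ideal_congr Ib); ring.
  apply: KJ'; apply: idealB => //; exact: KK.
by move/IK => Kab; apply: (ideal_congr (idealD iK Kab Kb)); ring.
Qed.

Lemma has_chain_mul_surj x J I J' I' n : is_ideal J -> I `<=` J ->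
  (forall a, I a -> I' (x * a)) -> J' `<=` lin x J I' ->
  has_chain J' I' n -> has_chain J I n.
Proof.
move=> iJ IJ xI surj [K [hK Klt]].
exists (fun i => J `&` quo (K i) x); split=> [i /hK[iK IK KJ]|i ltin].
  split; first by apply: is_ideal_setI => //; apply: quo_ideal.
    by move=> a Ia; split; [apply: IJ|apply: IK; apply: xI].
  by move=> a [].
have [iK IK KJ] := hK _ (ltnW ltin); have [iK' IK' KJ'] := hK _ ltin.
have [KK nKK] := Klt _ ltin.
split; first by move=> a [Ja ha]; split=> //; apply: KK.
move=> h; apply: nKK => z Kz.
have [a Ja Ia] := surj _ (KJ' _ Kz).
have /h[_ Ka] : (J `&` quo (K i.+1) x) a.
  split=> //.
  by apply: (ideal_congr (idealB iK' Kz (IK' _ Ia))); ring.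
by apply: (ideal_congr (idealD iK Ka (IK _ Ia))); ring.
Qed.

Lemma len_mul_le x J I J' I' : is_ideal I -> I `<=` J ->
  is_ideal J' -> is_ideal I' -> I' `<=` J' ->
  (forall a, J a -> J' (x * a)) -> (forall a, J a -> I' (x * a) -> I a) ->
  finl J' I' -> (len J I <= len J' I')%N.
Proof.
move=> iI IJ iJ' iI' IJ' xJ inj f'.
by apply: len_chn_le => // n; apply: has_chain_mul inj.
Qed.

Lemma len_mul x J I J' I' : is_ideal I -> is_ideal J -> I `<=` J ->
  is_ideal J' -> is_ideal I' -> I' `<=` J' ->
  (forall a, J a -> J' (x * a)) -> (forall a, J a -> I' (x * a) -> I a) ->
  (forall a, I a -> I' (x * a)) -> J' `<=` lin x J I' ->
  finl J' I' -> len J I = len J' I'.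
Proof.
move=> iI iJ IJ iJ' iI' IJ' xJ inj xI surj f'; apply/eqP; rewrite eqn_leq.
apply/andP; split; first exact: (len_mul_le _ _ _ _ _ xJ inj).
apply: len_chn_le => //; last by move=> n; apply: (has_chain_mul_surj iJ IJ xI surj).
by case: f' => n hn; exists n => k ck; apply: hn; apply: (has_chain_mul iJ' iI' IJ' xJ inj ck).
Qed.

Lemma len_cyclic x K : is_ideal K -> finl (adj x K) K ->
  len (adj x K) K = len setT (quo K x).
Proof.
move=> iK f; symmetry.
apply: (len_mul (x := x) (quo_ideal x iK) (@is_idealT A) _ (adj_ideal x iK)) => //.
- exact: sub_adj.
- by move=> a _; apply: adj_mul.
Qed.

Lemma finl_cyclic x K : is_ideal K -> finl setT (quo K x) -> finl (adj x K) K.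
Proof.
move=> iK [n hn]; exists n => k ck; apply: hn.
by apply: (has_chain_mul_surj (x := x) (@is_idealT A) _ _ _ ck).
Qed.

Lemma quot_length_finl J I : is_ideal I -> I `<=` J -> finl J I ->
  quot_length J I = ((len J I)%:Z)%:E.
Proof.
move=> iI IJ f; have [c mx] := lenP iI IJ f.
rewrite /quot_length /chain_sup.
set S := (X in supremum _ X).
have hS : supremums S ((len J I)%:Z)%:E.
  split=> [_ [n cn <-]|u hu]; last by apply: hu; exists (len J I).
  by rewrite lee_fin; have := mx _ cn; lia.
rewrite /supremum; case: ifPn => [/eqP S0|_].
  suff : S ((len J I)%:Z)%:E by rewrite S0.
  by exists (len J I).
exact: is_subset1_supremums (xgetI _ hS) hS.
Qed.

End Length.

(** * Noetherian local rings and systems of parameters *)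

Section Spans.
Variable A : comNzRingType.
Implicit Types (I J K L : set A) (x y z a b c : A).

Definition sp d (P : pred 'I_d) (w : 'I_d -> A) : set A :=
  [set s | exists a : 'I_d -> A, s = \sum_(k | P k) a k * w k].

Lemma sp_ideal d (P : pred 'I_d) w : is_ideal (sp P w).
Proof.
split.
- by exists (fun=> 0); rewrite big1 // => k _; rewrite mul0r.
- move=> _ _ [a ->] [b ->]; exists (fun k => a k + b k).
  by rewrite -big_split; apply: eq_bigr => k _; rewrite mulrDl.
- move=> c _ [a ->]; exists (fun k => c * a k).
  by rewrite mulr_sumr; apply: eq_bigr => k _; rewrite mulrA.
Qed.

Lemma sp_mem d (P : pred 'I_d) w k : P k -> sp P w (w k).
Proof.
move=> Pk; exists (fun i => if i == k then 1 else 0).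
rewrite (bigD1 k) //= eqxx mul1r big1 ?addr0 // => i /andP[_ /negPf->].
by rewrite mul0r.
Qed.

Lemma sp_sub d (P : pred 'I_d) w K : is_ideal K -> (forall k, P k -> K (w k)) ->
  sp P w `<=` K.
Proof.
move=> iK Kw _ [a ->]; apply: ideal_sum => // k Pk; apply: idealM => //; exact: Kw.
Qed.

Lemma spS d (P P' : pred 'I_d) w : {subset P <= P'} -> sp P w `<=` sp P' w.
Proof. by move=> PP'; apply: sp_sub => [|k /PP' Pk]; [exact: sp_ideal|exact: sp_mem]. Qed.

Lemma eq_sp d (P : pred 'I_d) w w' : (forall k, P k -> w k = w' k) -> sp P w = sp P w'.
Proof.
move=> ww'; apply/seteqP; split; apply: sp_sub => [|k Pk].
- exact: sp_ideal.
- by rewrite ww' //; apply: sp_mem.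
- exact: sp_ideal.
- by rewrite -ww' //; apply: sp_mem.
Qed.

Lemma ideal_gen_range d (w : 'I_d -> A) : ideal_gen (range w) = sp predT w.
Proof.
apply/seteqP; split.
  by apply: ideal_gen_sub => [|_ [k _ <-]]; [exact: sp_ideal|exact: sp_mem].
apply: sp_sub => [|k _]; first exact: ideal_gen_ideal.
by apply: sub_ideal_gen; exists k.
Qed.

Lemma adj_sp d (P : pred 'I_d) w i : P i ->
  sp P w = adj (w i) (sp [pred k | P k & k != i] w).
Proof.
move=> Pi; apply/seteqP; split.
  apply: sp_sub => [|k Pk]; first by apply: adj_ideal; apply: sp_ideal.
  case: (eqVneq k i) => [->|ki]; first by apply: adj_id; apply: sp_ideal.
  by apply: sub_adj; apply: sp_mem; rewrite /= Pk.
apply: adj_sub; [exact: sp_ideal|exact: sp_mem|].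
by apply: spS => k /andP[].
Qed.

Definition upd d (w : 'I_d -> A) i x : 'I_d -> A := fun k => if k == i then x else w k.

Lemma upd_i d (w : 'I_d -> A) i x : upd w i x i = x.
Proof. by rewrite /upd eqxx. Qed.

Lemma upd_ne d (w : 'I_d -> A) i x k : k != i -> upd w i x k = w k.
Proof. by rewrite /upd => /negPf ->. Qed.

Lemma upd_upd d (w : 'I_d -> A) i x y : upd (upd w i x) i y = upd w i y.
Proof. by apply/funext => k; rewrite /upd; case: eqP. Qed.

Lemma upd_id d (w : 'I_d -> A) i : upd w i (w i) = w.
Proof. by apply/funext => k; rewrite /upd; case: eqP => // ->. Qed.

Lemma sp_upd d (P : pred 'I_d) w i x : ~~ P i -> sp P (upd w i x) = sp P w.
Proof.
move=> nPi; apply: eq_sp => k Pk; rewrite upd_ne //.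
by apply: contraNneq nPi => <-.
Qed.

Lemma sp_updT d (w : 'I_d -> A) i x : sp predT (upd w i x) = adj x (sp (predC1 i) w).
Proof.
rewrite (@adj_sp _ _ _ i) // upd_i; congr adj.
by rewrite sp_upd //= eqxx.
Qed.

Lemma sp_adjT d (w : 'I_d -> A) i : sp predT w = adj (w i) (sp (predC1 i) w).
Proof. by rewrite -{1}(upd_id w i) sp_updT. Qed.

End Spans.

(** * Radicals, and powers of ideals through monomials in the generators *)

Section Powers.
Variable A : comNzRingType.
Implicit Types (I J K L : set A) (x y z a b c : A).

Definition rad I : set A := [set p | exists n, I (p ^+ n)].

Lemma rad_ideal I : is_ideal I -> is_ideal (rad I).
Proof.
move=> iI; split.
- by exists 1%N; rewrite expr1; apply: ideal0.
- move=> x y [n hn] [k hk]; exists (n + k)%N; rewrite exprDn.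
  apply: ideal_sum => // i _; rewrite -mulr_natr; apply: idealMr => //.
  case: (leqP k i) => hi.
    apply: idealM => //; rewrite -(subnK hi) exprD; exact: idealM.
  apply: idealMr => //.
  have -> : (n + k - i = (k - i) + n)%N by lia.
  by rewrite exprD; apply: idealM.
- by move=> a x [n hn]; exists n; rewrite exprMn; apply: idealM.
Qed.

Lemma sub_rad I : I `<=` rad I.
Proof. by move=> x Ix; exists 1%N; rewrite expr1. Qed.

Lemma rad_exp I x n : rad I (x ^+ n) -> rad I x.
Proof. by case=> k; rewrite -exprM => h; exists (n * k)%N. Qed.

Lemma radS I J : I `<=` J -> rad I `<=` rad J.
Proof. by move=> IJ x [n /IJ h]; exists n. Qed.

Lemma rad_rad I : rad (rad I) `<=` rad I.
Proof. by move=> x [n /rad_exp]. Qed.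

Definition mono d (w : 'I_d -> A) (e : 'I_d -> nat) : A := \prod_i w i ^+ e i.

Definition mpow d (w : 'I_d -> A) n : set A :=
  ideal_gen [set mono w e | e in [set e : 'I_d -> nat | (\sum_i e i)%N = n]].

Lemma monoD d (w : 'I_d -> A) e f :
  mono w (fun i => e i + f i)%N = mono w e * mono w f.
Proof. by rewrite /mono -big_split; apply: eq_bigr => i _; rewrite exprD. Qed.

Lemma mono_mul d (w : 'I_d -> A) i e :
  w i * mono w e = mono w (fun k => (k == i) + e k)%N.
Proof.
rewrite monoD; congr (_ * _).
rewrite /mono (bigD1 i) //= eqxx expr1 big1 ?mulr1 // => k /negPf ->.
by rewrite expr0.
Qed.

Lemma sum_delta d (k : 'I_d) (e : 'I_d -> nat) :
  (\sum_i ((i == k) + e i) = (\sum_i e i).+1)%N.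
Proof.
rewrite big_split /= [X in (X + _)%N](bigD1 k) //= eqxx big1 ?addn0 ?add1n //.
by move=> i /negPf ->.
Qed.

Lemma mpow_mono d (w : 'I_d -> A) e : mpow w (\sum_i e i) (mono w e).
Proof. by apply: sub_ideal_gen; exists e. Qed.

Lemma ideal_pow_ideal I n : is_ideal (ideal_pow I n).
Proof. by case: n => [|n]; [exact: is_idealT|exact: ideal_gen_ideal]. Qed.

Lemma ideal_pow_mpow d (w : 'I_d -> A) n : ideal_pow (sp predT w) n = mpow w n.
Proof.
elim: n => [|n IHn]; apply/seteqP; split.
- move=> z _; rewrite -(mulr1 z); apply: (@idealM _ (mpow w 0)).
    exact: ideal_gen_ideal.
  apply: sub_ideal_gen; exists (fun=> 0%N) => /=; first by rewrite big1.
  by rewrite /mono big1 // => i _; rewrite expr0.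
- by [].
- rewrite /ideal_pow iterS -/(ideal_pow _ _) IHn.
  apply: ideal_gen_sub => [|_ [x Qx [y hy <-]]]; first exact: ideal_gen_ideal.
  suff : sp predT w `<=` quo (mpow w n.+1) y by move/(_ _ Qx); rewrite /quo /= mulrC.
  apply: sp_sub => [|k _]; first by apply: quo_ideal; apply: ideal_gen_ideal.
  rewrite /quo /= mulrC.
  suff : mpow w n `<=` quo (mpow w n.+1) (w k) by apply.
  apply: ideal_gen_sub; first by apply: quo_ideal; apply: ideal_gen_ideal.
  move=> _ [e /= <- <-]; rewrite /quo /= mono_mul.
  rewrite -(sum_delta k); exact: mpow_mono.
- apply: ideal_gen_sub; first exact: ideal_gen_ideal.
  move=> _ [e /= he <-].
  have [k hk] : exists k, (0 < e k)%N.
    apply: contrapT => /forallNP h; suff : (\sum_i e i = 0)%N by rewrite he.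
    by apply: big1 => i _; have := h i; lia.
  pose f i := (e i - (i == k))%N.
  have ef : e = (fun i => (i == k) + f i)%N.
    by apply/funext => i; rewrite /f; case: eqP => [->|_] /=; lia.
  rewrite ef -mono_mul; apply: sub_ideal_gen.
  exists (w k); first exact: sp_mem.
  exists (mono w f) => //; rewrite -/(ideal_pow _ _) IHn.
  have -> : n = (\sum_i f i)%N.
    by have := he; rewrite ef sum_delta => -[].
  exact: mpow_mono.
Qed.

Lemma ideal_powS I n : is_ideal I -> ideal_pow I n.+1 `<=` ideal_pow I n.
Proof.
move=> iI; rewrite {1}/ideal_pow iterS -/(ideal_pow _ _).
apply: ideal_gen_sub => [|_ [x _ [y hy <-]]]; first exact: ideal_pow_ideal.
by apply: idealM => //; apply: ideal_pow_ideal.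
Qed.

Lemma ideal_pow_le I n k : is_ideal I -> (n <= k)%N -> ideal_pow I k `<=` ideal_pow I n.
Proof.
move=> iI; elim: k => [|k IHk]; first by rewrite leqn0 => /eqP ->.
rewrite leq_eqVlt => /predU1P[->//|]; rewrite ltnS => /IHk.
by apply: subset_trans; apply: ideal_powS.
Qed.

Lemma ideal_pow1 I : is_ideal I -> ideal_pow I 1 `<=` I.
Proof.
by move=> iI; apply: ideal_gen_sub => // _ [x Ix [y _ <-]]; apply: idealMr.
Qed.

Lemma exp_ideal_pow I x n : I x -> ideal_pow I n (x ^+ n).
Proof.
move=> Ix; elim: n => [//|n IHn]; rewrite exprS.
by apply: sub_ideal_gen; exists x => //; exists (x ^+ n).
Qed.

(* pigeonhole on exponents *)
Lemma ideal_pow_exp d (w : 'I_d -> A) k n N : (0 < k)%N -> (k * n + d * k.-1 <= N)%N ->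
  ideal_pow (sp predT w) N `<=` ideal_pow (sp predT (fun i => w i ^+ k)) n.
Proof.
move=> k0 hN; rewrite ideal_pow_mpow.
apply: ideal_gen_sub; first exact: ideal_pow_ideal.
move=> _ [e /= he <-].
have -> : mono w e = mono (fun i => w i ^+ k) (fun i => e i %/ k)%N * mono w (fun i => e i %% k)%N.
  rewrite /mono -big_split; apply: eq_bigr => i _ /=.
  by rewrite -exprM -exprD mulnC -divn_eq.
apply: idealMr; first exact: ideal_pow_ideal.
apply: (@ideal_pow_le _ n (\sum_i (e i %/ k))%N); first exact: sp_ideal.
  have h : (\sum_i e i <= \sum_i (k * (e i %/ k) + k.-1))%N.
    apply: leq_sum => i _; rewrite {1}(divn_eq (e i) k) mulnC leq_add2l.
    by have := ltn_pmod (e i) k0; lia.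
  move: h; rewrite he big_split /= -big_distrr /= sum_nat_const card_ord.
  by move=> h; rewrite -(leq_pmul2l k0); lia.
rewrite ideal_pow_mpow; exact: mpow_mono.
Qed.

Lemma ideal_pow_expn d (w : 'I_d -> A) k n :
  ideal_pow (sp predT (fun i => w i ^+ k)) n `<=` ideal_pow (sp predT w) (k * n).
Proof.
rewrite !ideal_pow_mpow; apply: ideal_gen_sub; first exact: ideal_gen_ideal.
move=> _ [e /= <- <-].
have -> : mono (fun i => w i ^+ k) e = mono w (fun i => k * e i)%N.
  by apply: eq_bigr => i _; rewrite exprM.
rewrite big_distrr; exact: mpow_mono.
Qed.

End Powers.

Section NoetherianLocal.
Variables (A : comNzRingType) (m : set A).
Hypotheses (noethA : is_noetherian A) (localA : is_local_ring m).
Implicit Types (I J K L : set A) (x y z a b c p : A).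

Lemma noeth_acc (K : nat -> set A) : (forall n, is_ideal (K n)) ->
  (forall n, K n `<=` K n.+1) -> exists N, forall n, K n `<=` K N.
Proof.
move=> iK KS.
have Kle i j : (i <= j)%N -> K i `<=` K j.
  elim: j => [|j IHj]; first by rewrite leqn0 => /eqP ->.
  rewrite leq_eqVlt => /predU1P[->//|]; rewrite ltnS => /IHj h.
  exact: subset_trans (KS j).
pose U : set A := [set x | exists n, K n x].
have iU : is_ideal U.
  split.
  - by exists 0%N; apply: ideal0.
  - move=> x y [i hi] [j hj]; exists (maxn i j); apply: idealD => //.
      by apply: Kle hi; rewrite leq_maxl.
    by apply: Kle hj; rewrite leq_maxr.
  - by move=> a x [i hi]; exists i; apply: idealM.
have [r [g Ug]] := noethA iU; rewrite ideal_gen_range in Ug.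
have gU k : exists n, K n (g k) by have : U (g k) by rewrite Ug; apply: sp_mem.
have [f hf] := choice gU.
exists (\max_k f k)%N => n z Kz.
have : U z by exists n.
rewrite Ug; apply: sp_sub => // k _; apply: Kle (hf k); exact: leq_bigmax.
Qed.

Lemma quo_stable I x : is_ideal I ->
  exists N, forall n, quo I (x ^+ n) `<=` quo I (x ^+ N).
Proof.
move=> iI; apply: noeth_acc => n; first exact: quo_ideal.
move=> z hz; rewrite /quo /= exprS.
by apply: (ideal_congr (idealM x iI hz)); ring.
Qed.

Lemma noeth_max (P : set A -> Prop) I : is_ideal I -> P I ->
  exists L, [/\ is_ideal L, P L & forall L', is_ideal L' -> P L' -> L `<=` L' -> L' `<=` L].
Proof.
move=> iI PI; apply: contrapT => h.
pose T := {L : set A | is_ideal L /\ P L}.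
have next (L : T) : exists L' : T, sval L `<` sval L'.
  case: L => L [iL PL] /=; apply: contrapT => hL; apply: h.
  exists L; split=> // L' iL' PL' LL'; apply: contrapT => nL'; apply: hL.
  by exists (exist _ L' (conj iL' PL')).
have [f hf] := choice next.
pose K n := iter n f (exist _ I (conj iI PI)).
have [N hN] := @noeth_acc (fun n => sval (K n)) (fun n => proj1 (svalP (K n)))
  (fun n => proj1 (hf (K n))).
by case: (hf (K N)) => _; apply; apply: (hN N.+1).
Qed.

Lemma max_ideal : is_ideal m. Proof. by case: localA => -[]. Qed.

Lemma nmax1 : ~ m 1.
Proof.
move=> m1; case: localA => -[im mT _] _; apply: mT; apply/seteqP; split=> // z _.
by rewrite -(mulr1 z); apply: idealM.
Qed.

Lemma proper_sub_max I : is_ideal I -> ~ I 1 -> I `<=` m.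
Proof.
move=> iI nI1.
have [L [[iL IL] nL1 mxL]] : exists L, [/\ is_ideal L /\ I `<=` L, ~ L 1 &
    forall L', is_ideal L' -> ~ L' 1 -> L `<=` L' -> L' `<=` L].
  have [L [iL [IL nL] mx]] := @noeth_max (fun L => I `<=` L /\ ~ L 1) I iI (conj (fun z => id) nI1).
  exists L; split=> // L' iL' nL' LL'; apply: mx => //; split=> //.
  exact: subset_trans LL'.
case: localA => _ /(_ L) <- //; split=> //; first by move=> LT; apply: nL1; rewrite LT.
move=> J iJ LJ; case: (pselect (J 1)) => J1; [right|left].
  by apply/seteqP; split=> // z _; rewrite -(mulr1 z); apply: idealM.
by apply/seteqP; split=> //; apply: mxL.
Qed.

(** If [c] were not in [I], the ideal [I : c] would be proper, hence inside [m]; both [1 - p] and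
    [p] would then lie in [m]. *)
Lemma cancel_unit I p c : is_ideal I -> m p -> I ((1 - p) * c) -> I c.
Proof.
move=> iI mp h; apply: contrapT => nIc.
have : quo I c `<=` m.
  apply: proper_sub_max; first exact: quo_ideal.
  by rewrite /quo /= mulr1.
move/(_ (1 - p)); rewrite /quo /= mulrC => /(_ h) m1p.
by apply: nmax1; apply: (ideal_congr (idealD max_ideal m1p mp)); ring.
Qed.

(** Noetherian induction: let [L] be maximal among the ideals containing [I] with a quotient of
    infinite length. If [p] in [m] avoids [L] and [g] is its last power outside [L], then [L + (g)]
    and [L : g] are strictly larger than [L], and their finite colengths bound the length of
    [A / L]. *)
Lemma finl_rad I : is_ideal I -> m `<=` rad I -> finl setT I.
Proof.
move=> iI mI; apply: contrapT => nf.
have [L [iL [IL nfL] mx]] := @noeth_max (fun L => I `<=` L /\ ~ finl setT L) I iI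
  (conj (fun z => id) nf).
have Lbig L' : is_ideal L' -> L `<` L' -> finl setT L'.
  move=> iL' [LL' nLL']; apply: contrapT => nf'; apply: nLL'; apply: mx => //.
  by split=> //; apply: subset_trans LL'.
case: (pselect (L 1)) => L1.
  apply: nfL; exists 0%N => k [K [hK Klt]]; rewrite leqNgt; apply/negP => k0.
  have [_ nK] := Klt 0%N k0; apply: nK => z _.
  have [iK LK _] := hK 0%N isT.
  by rewrite -(mulr1 z); apply: idealM => //; apply: LK.
have Lm : L `<=` m by apply: proper_sub_max.
case: (pselect (m `<=` L)) => mL.
  have mLe : m = L by apply/seteqP.
  apply: nfL; exists 1%N => k [K [hK Klt]]; rewrite leqNgt; apply/negP => k1.
  have [K0 nK0] := Klt 0%N (ltnW k1); have [K1 nK1] := Klt 1%N k1.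
  have [iK1 LK1 _] := hK 1%N (ltnW k1).
  case: (pselect (K 1%N 1)) => h1.
    by apply: nK1 => z _; rewrite -(mulr1 z); apply: idealM.
  have [_ LK0 _] := hK 0%N isT.
  apply: nK0; apply: subset_trans LK0; rewrite -mLe; exact: proper_sub_max.
have [p [mp nLp]] : exists p, m p /\ ~ L p.
  by apply: contrapT => /forallNP h; apply: mL => p mp; have /not_andP[//|/contrapT] := h p.
have ex : exists n, `[< L (p ^+ n) >].
  have [n hn] := mI _ mp; exists n; apply: asboolT; exact: IL.
have [n /asboolW Ln nmin] := ex_minnP ex.
case: n Ln nmin => [|n] Ln nmin; first by move: Ln; rewrite expr0.
pose g := p ^+ n.
have nLg : ~ L g by move=> Lg; have := nmin n (asboolT Lg); rewrite ltnn.
have f1 : finl setT (adj g L).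
  apply: Lbig; first exact: adj_ideal.
  by split; [exact: sub_adj|move/(_ g (adj_id g iL))].
have f2 : finl (adj g L) L.
  apply: finl_cyclic => //; apply: Lbig; first exact: quo_ideal.
  split; first exact: sub_quo.
  by move/(_ p); apply: contra_not nLp; apply; rewrite /quo /= /g -exprSr.
apply: nfL; apply: (finl_add iL (adj_ideal g iL) (@is_idealT A)) => //.
exact: sub_adj.
Qed.

(* Krull's intersection theorem: if c is not in K, take L containing K maximal
   among the ideals avoiding c; every larger ideal contains c, so m c <= L and
   every element of m is nilpotent modulo L. *)
Lemma krull_inter d (P : pred 'I_d) (w : 'I_d -> A) K c : is_ideal K ->
  (forall i, P i -> m (w i)) ->
  (forall n, lin 1 (sp P (fun i => w i ^+ n)) K c) -> K c.
Proof.
move=> iK mw hc; apply: contrapT => nKc.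
have [L [iL [KL nLc] mx]] := @noeth_max (fun L => K `<=` L /\ ~ L c) K iK
  (conj (fun z => id) nKc).
have Lbig L' : is_ideal L' -> L `<=` L' -> ~ L' `<=` L -> L' c.
  move=> iL' LL' nLL'; apply: contrapT => nc; apply: nLL'; apply: mx => //.
  by split=> //; apply: subset_trans LL'.
have mc p : m p -> L (p * c).
  move=> mp; apply: contrapT => npc.
  have [|a _ h] := Lbig (adj (p * c) L) (adj_ideal _ iL) (@sub_adj _ _ _).
    by move/(_ _ (adj_id (p * c) iL)).
  apply: nLc; apply: (@cancel_unit L (p * a)) => //.
    by apply: idealMr => //; apply: max_ideal.
  by apply: (ideal_congr h); ring.
have nil p : m p -> exists n, L (p ^+ n).
  move=> mp.
  have [j hj] := quo_stable p iL.
  exists j; apply: contrapT => npj.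
  have [|a _ h] := Lbig (adj (p ^+ j) L) (adj_ideal _ iL) (@sub_adj _ _ _).
    by move/(_ _ (adj_id (p ^+ j) iL)).
  have : quo L (p ^+ j.+1) a.
    rewrite /quo /=; apply: (ideal_congr (idealB iL (mc _ mp) (idealM p iL h))).
    by rewrite exprS; ring.
  move/hj; rewrite /quo /= => h2; apply: nLc.
  by apply: (ideal_congr (idealD iL h h2)); ring.
have ex k : exists n, P k -> L (w k ^+ n).
  case Pk : (P k); last by exists 0%N.
  by have [n hn] := nil _ (mw _ Pk); exists n.
have [f hf] := choice ex.
apply: nLc; case: (hc (\max_k f k)%N) => s ss /KL h.
have Ls : L s.
  move: s ss {h}; apply: sp_sub => // k Pk.
  have /subnK <- : (f k <= \max_k f k)%N by exact: leq_bigmax.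
  by rewrite exprD; apply: idealM => //; apply: hf.
by apply: (ideal_congr (idealD iL h Ls)); ring.
Qed.

(** Stating the m-primary condition with the radical reduces a change of parameters to a check on
    generators ([sop_trans]). Finite generation of [m] makes it equivalent to [is_sop]. *)
Definition sop d (w : 'I_d -> A) :=
  (forall i, m (w i)) /\ m `<=` rad (sp predT w).

Lemma is_sopE d (w : 'I_d -> A) : is_sop m w <-> sop w.
Proof.
split=> -[mw h]; split=> //.
  case: h => n hn p mp; exists n; rewrite -ideal_gen_range; apply: hn.
  exact: exp_ideal_pow.
have [r [g mg]] := noethA max_ideal; rewrite ideal_gen_range in mg.
have ex k : exists n, sp predT w (g k ^+ n).
  by apply: h; rewrite mg; apply: sp_mem.
have [f hf] := choice ex.
pose N := (\max_k f k).+1.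
(* The exponent comes from [ideal_pow_exp] with [n = 1]: each monomial of that degree is divisible
   by some [g k ^+ N]. *)
exists (N + r * N.-1)%N; rewrite mg ideal_gen_range.
apply: subset_trans (@ideal_pow_exp _ _ g N 1 _ _ _) _ => //; first by rewrite muln1.
apply: subset_trans (ideal_pow1 (sp_ideal _ _)) _.
apply: sp_sub => [|k _]; first exact: sp_ideal.
have /subnK <- : (f k <= N)%N by rewrite /N ltnW // ltnS; exact: leq_bigmax.
by rewrite exprD; apply: idealM; [exact: sp_ideal|exact: hf].
Qed.

Lemma sop_finl d (w : 'I_d -> A) I : sop w -> is_ideal I -> sp predT w `<=` I ->
  finl setT I.
Proof.
move=> [_ mw] iI wI; apply: finl_rad => //.
exact: subset_trans (radS wI).
Qed.

Lemma sop_trans d (w w' : 'I_d -> A) : sop w -> (forall i, m (w' i)) ->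
  (forall i, rad (sp predT w') (w i)) -> sop w'.
Proof.
move=> [_ h] mw' hw; split=> // p /h hp.
apply: rad_rad; apply: radS hp; apply: sp_sub => //.
by apply: rad_ideal; apply: sp_ideal.
Qed.

Lemma sop_pow d (w : 'I_d -> A) k : sop w -> (0 < k)%N -> sop (fun i => w i ^+ k).
Proof.
move=> sw; case: k => // k _; apply: (sop_trans sw) => i.
  by rewrite exprS; apply: idealMr; [exact: max_ideal|case: sw].
by exists k.+1; apply: (sp_mem (fun i => w i ^+ k.+1)).
Qed.

Lemma sop_upd d (w : 'I_d -> A) i x : sop w -> m x ->
  rad (adj x (sp (predC1 i) w)) (w i) -> sop (upd w i x).
Proof.
move=> sw mx hx; apply: (sop_trans sw) => k.
  by rewrite /upd; case: eqP => // _; case: sw.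
case: (eqVneq k i) => [->|ki]; first by rewrite sp_updT.
by apply: sub_rad; rewrite -(upd_ne w x ki); apply: sp_mem.
Qed.

End NoetherianLocal.

(** * Colon ideals of parameters *)

Section WeakSequences.
Variables (A : comNzRingType) (m : set A).
Hypotheses (noethA : is_noetherian A) (localA : is_local_ring m).
Implicit Types (I J K L : set A) (x y z a b c p : A).

Lemma len_eq_sub I I' : is_ideal I -> is_ideal I' -> I `<=` I' -> finl setT I ->
  len setT I = len setT I' -> I' `<=` I.
Proof.
move=> iI iI' II' f e; apply: len_eq0 => //; first exact: finlS f.
have := len_add iI iI' (@is_idealT A) II' (@subsetT _ _) f; rewrite e; lia.
Qed.

(* A substitute for prime avoidance: the chain of the I : prod_(k < n) (p + x^k)
   is stationary, and p + x^k acts as x^k - x^M on the kernel of p + x^M. *)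
Lemma nzd_family I x p : is_ideal I -> m x ->
  (forall c, I (x * c) -> I (p * c) -> I c) ->
  exists M0, forall M, (M0 <= M)%N -> forall c, I ((p + x ^+ M) * c) -> I c.
Proof.
move=> iI mx nzd.
pose pr n := \prod_(k < n) (p + x ^+ k).
have [N hN] : exists N, forall n, quo I (pr n) `<=` quo I (pr N).
  apply: (noeth_acc noethA) => n; first exact: quo_ideal.
  move=> z hz; rewrite /quo /= /pr big_ord_recr /= -/(pr n).
  by apply: (ideal_congr (idealM (p + x ^+ n) iI hz)); ring.
exists N.+1 => M hM c hc.
have down n c' : (n <= M)%N -> I ((p + x ^+ M) * c') -> I (pr n * c') ->
    exists s, I (x ^+ s * c').
  elim: n c' => [|n IHn] c' hn hc'.
    by rewrite /pr big_ord0 => h; exists 0%N; rewrite expr0.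
  rewrite /pr big_ord_recr /= -/(pr n) => h.
  have [||s hs] := IHn ((x ^+ n - x ^+ M) * c') (ltnW hn).
  - by apply: (ideal_congr (idealM (x ^+ n - x ^+ M) iI hc')); ring.
  - by apply: (ideal_congr (idealB iI h (idealM (pr n) iI hc'))); ring.
  (* [x^n - x^M = x^n (1 - x^(M - n))], and the last factor is a unit because [n < M]. *)
  exists (s + n)%N; apply: (cancel_unit noethA localA (p := x ^+ (M - n)) iI).
    have -> : (M - n = (M - n).-1.+1)%N by lia.
    by rewrite exprS; apply: idealMr => //; apply: max_ideal.
  apply: (ideal_congr hs); rewrite -{1}(subnK (ltnW hn)) !exprD; ring.
have [|||s] := down N c.
- exact: ltnW.
- by [].
- by apply: (hN M.+1); rewrite /quo /= /pr big_ord_recr /= -mulrA; apply: idealM.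
(* Descent on the power of [x]: from [(p + x^M) c] and [x^(s+1) c] in [I] one gets [p x^s c] in [I],
   since [M > 0]; so [nzd] applies to [x^s c]. *)
elim: s => [|s IHs]; first by rewrite expr0 mul1r.
rewrite exprS -mulrA => hs; apply: IHs; apply: nzd => //.
rewrite (_ : M = M.-1.+1) in hc; last by lia.
rewrite exprS in hc.
by apply: (ideal_congr (idealB iI (idealM (x ^+ s) iI hc) (idealM (x ^+ M.-1) iI hs))); ring.
Qed.

Variable d : nat.
Implicit Types (w : 'I_d -> A) (i j : 'I_d).

Hypothesis linear_len : forall w, sop m w -> forall i, exists e c : int, forall n, (0 < n)%N ->
  (len setT (sp predT (upd w i (w i ^+ n))))%:Z = n%:Z * e + c.

Let ideal_J w i : is_ideal (sp (predC1 i) w) := @sp_ideal A d (predC1 i) w.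

Lemma sop_mem w i : sop m w -> m (w i). Proof. by case. Qed.

Lemma sop_upd_pow w i n : sop m w -> (0 < n)%N -> sop m (upd w i (w i ^+ n)).
Proof.
move=> sw; case: n => // n _; apply: (sop_upd sw).
  by rewrite exprS; apply: idealMr; [exact: max_ideal localA|exact: sop_mem].
by exists n.+1; apply: adj_id.
Qed.

(* Linearity of the length makes (x) + (J : x^n) independent of n >= 1; hence
   W = J : x^oo satisfies W <= x W + (J : x), and x^N W <= J gives W = J : x. *)
Lemma quo_exp w i n c : sop m w -> sp (predC1 i) w (w i ^+ n * c) ->
  sp (predC1 i) w (w i * c).
Proof.
move=> sw; set x := w i; set J := sp _ _.
have iJ : is_ideal J := ideal_J w i.
pose Q n := adj (x ^+ n) J.
have iQ k : is_ideal (Q k) by apply: adj_ideal.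
have fQ k : (0 < k)%N -> finl setT (Q k).
  move=> k0; apply: (sop_finl noethA localA (sop_upd_pow i sw k0)) => //.
  by rewrite sp_updT.
pose B n := adj x (quo J (x ^+ n)).
have iB k : is_ideal (B k) by apply: adj_ideal; apply: quo_ideal.
have [e [cc hL]] := linear_len sw i.
have QQ k : Q k.+1 `<=` Q k.
  apply: adj_sub => //; last exact: sub_adj.
  by rewrite exprSr; apply: adj_mul.
have QB k : Q 1%N `<=` B k.
  by apply: linS => //; apply: sub_quo.
(* Multiplication by [x^k] identifies [A / B k] with [Q k / Q k.+1], whose length is the slope of
   the affine function. *)
have lB k : (0 < k)%N -> (len setT (B k))%:Z = e.
  move=> k0.
  have -> : len setT (B k) = len (Q k) (Q k.+1).
    apply: (len_mul (x := x ^+ k) (iB k) (@is_idealT A) _ (iQ k) (iQ k.+1)) => //.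
    - by move=> a _; apply: adj_mul.
    - move=> a _ [b _ h]; exists b => //; rewrite /quo /=.
      by apply: (ideal_congr h); rewrite exprSr; ring.
    - move=> a [b _ h]; exists b => //.
      by apply: (ideal_congr (h : J _)); rewrite exprSr; ring.
    - by apply: linS => //; apply: sub_adj.
    - by apply: finlS (fQ k.+1 isT).
  have := hL k k0; have := hL k.+1 isT; rewrite !sp_updT -/x -/J -/(Q k) -/(Q k.+1).
  rewrite (len_add (iQ k.+1) (iQ k) (@is_idealT A) (QQ k) (@subsetT _ _) (fQ k.+1 isT)).
  have -> : k.+1%:Z = k%:Z + 1 by lia.
  by rewrite mulrDl mul1r PoszD => h1 h2; lia.
have B1 k : B k.+1 `<=` B 1%N.
  have f1 : finl setT (B 1%N) by apply: finlS (fQ 1%N isT) => //; exact: QB.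
  apply: len_eq_sub => //.
    by apply: linS => // a h; rewrite /quo /= exprSr -mulrA; apply: idealM; rewrite // expr1 in h *.
  by have := lB 1%N isT; have := lB k.+1 isT; lia.
have [N hN] := quo_stable noethA x iJ.
have step k a n' : J (x ^+ n' * a) ->
    exists b n'', J (x ^+ n'' * b) /\ J (x * (a - x ^+ k * b)).
  move=> ha; elim: k => [|k IHk].
    by exists a, n'; split=> //; rewrite expr0 mul1r subrr mulr0; apply: ideal0.
  have [b [n2 [hb hab]]] := IHk.
  have [|b' _ hb'] := B1 n2 b.
    by apply: sub_adj; rewrite /quo /= exprS -mulrA; apply: idealM.
  rewrite /quo /= expr1 in hb'.
  exists b', n2.+2; split.
    apply: (ideal_congr (idealB iJ (idealM x iJ hb) (idealM (x ^+ n2) iJ hb'))).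
    by rewrite !exprS; ring.
  by apply: (ideal_congr (idealD iJ hab (idealM (x ^+ k) iJ hb'))); rewrite exprS; ring.
move=> hc; have [b [n2 [hb hcb]]] := step N c n hc.
have /= hNb := hN n2 b hb.
by apply: (ideal_congr (idealD iJ hcb (idealM x iJ hNb))); ring.
Qed.

Lemma quo_exp_nzd w i n c : sop m w ->
  quo (sp (predC1 i) w) (w i) (w i ^+ n * c) -> quo (sp (predC1 i) w) (w i) c.
Proof. by move=> sw; rewrite /quo /= mulrA -exprS; apply: quo_exp. Qed.

(* In the one-dimensional ring A / W with W = J : x, the length of
   A / ((z, x^n) + W) equals that of (((x^n) + W) : z) / ((x^n) + W), which is
   bounded by Artin-Rees; so (z, x^n) + W is stationary in n. *)
Lemma sop_upd_nzd w i z : sop m w -> m z ->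
  (forall c, quo (sp (predC1 i) w) (w i) (z * c) -> quo (sp (predC1 i) w) (w i) c) ->
  sop m (upd w i z).
Proof.
move=> sw mz; set x := w i; set J := sp _ _; set W := quo J x => nzd.
have iJ : is_ideal J := ideal_J w i.
have iW : is_ideal W by apply: quo_ideal.
have JW : J `<=` W by apply: sub_quo.
have xW n c : W (x ^+ n * c) -> W c by apply: quo_exp_nzd.
pose U := adj z W; have iU : is_ideal U by apply: adj_ideal.
have [c0 hc0] := quo_stable noethA x iU.
(* An Artin-Rees constant: if [x^n v] lies in [U], so does [x^r v]. The successor makes [r]
   positive, so that [T (n + r)] has finite colength even for [n = 0]. *)
pose r := c0.+1.
have hr n v : U (x ^+ n * v) -> U (x ^+ r * v).
  by move/(hc0 n) => h; rewrite /r exprS -mulrA; apply: idealM.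
pose T n := adj (x ^+ n) W; have iT n : is_ideal (T n) by apply: adj_ideal.
have fT n : (0 < n)%N -> finl setT (T n).
  move=> n0; apply: (sop_finl noethA localA (sop_upd_pow i sw n0)) => //.
  by rewrite sp_updT; apply: adjS.
have TS n k : T (n + k)%N `<=` T n.
  apply: adj_sub => //; last exact: sub_adj.
  by rewrite exprD; apply: adj_mul.
pose S n := adj z (T n); have iS n : is_ideal (S n) by apply: adj_ideal.
have TTS n : T n `<=` S n by apply: sub_adj.
have lS n : (len setT (S (n + r)%N) <= len setT (T r))%N.
  have f : finl setT (T (n + r)%N) by apply: fT; lia.
  have iq := quo_ideal z (iT (n + r)%N).
  have sq : T (n + r)%N `<=` quo (T (n + r)%N) z by apply: sub_quo.
  have f2 : finl (S (n + r)%N) (T (n + r)%N) by apply: finlS f.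
  have e1 := len_cyclic (iT (n + r)%N) f2.
  have e2 := len_add (iT _) (iS (n + r)%N) (@is_idealT A) (TTS _) (@subsetT _ _) f.
  have e3 := len_add (iT _) iq (@is_idealT A) sq (@subsetT _ _) f.
  have le1 : (len (quo (T (n + r)%N) z) (T (n + r)%N) <= len (T n) (T (n + r)%N))%N.
    apply: len_sub => //; last by apply: finlS f.
    move=> u [v _ hv].
    have [v' _ hv'] : U (x ^+ r * v).
      apply: (hr (n + r)%N); exists u => //.
      by apply: (ideal_congr (idealN iW hv)); ring.
    exists v' => //; apply: nzd.
    apply: (ideal_congr (idealD iW hv (idealM (x ^+ n) iW hv'))).
    by rewrite exprD; ring.
  have e4 : len setT (T r) = len (T n) (T (n + r)%N).
    apply: (len_mul (x := x ^+ n) (iT r) (@is_idealT A) _ (iT n) (iT (n + r)%N)) => //.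
    - by move=> a _; apply: adj_mul.
    - move=> a _ [b _ h]; exists b => //; apply: (xW n).
      by apply: (ideal_congr h); rewrite exprD; ring.
    - move=> a [b _ h]; exists b => //.
      by apply: (ideal_congr (idealM (x ^+ n) iW h)); rewrite exprD; ring.
    - by apply: linS => //; apply: sub_adj.
    - by apply: finlS f.
  move: e1 e2 e3 le1 e4; rewrite -/(S _) /=; lia.
have [n hn] : exists n, S (n + r)%N `<=` S (n + r).+1.
  apply: contrapT => /forallNP nS.
  have big n : (n <= len setT (S (n + r)%N))%N.
    elim: n => [//|n IHn].
    have SS : S (n.+1 + r)%N `<=` S (n + r)%N.
      by apply: adjS; rewrite addSn -addn1; apply: TS.
    have f : finl setT (S (n.+1 + r)%N) by apply: finlS (fT (n.+1 + r)%N _) => //; lia.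
    rewrite (len_add (iS _) (iS (n + r)%N) (@is_idealT A) SS (@subsetT _ _) f).
    suff : (0 < len (S (n + r)%N) (S (n.+1 + r)%N))%N by move: IHn; lia.
    rewrite lt0n; apply/eqP => l0; apply: (nS n); rewrite -addSn.
    by apply: len_eq0 l0 => //; apply: finlS f.
  by have := big (len setT (T r)).+1; have := lS (len setT (T r)).+1; lia.
have [a _ [b _ h]] : S (n + r).+1 (x ^+ (n + r)) by apply: hn; apply: TTS; apply: adj_id.
have hU : U (x ^+ (n + r)).
  apply: (cancel_unit noethA localA (p := x * b) iU).
    by apply: idealMr; [exact: max_ideal localA|exact: sop_mem].
  by exists a => //; apply: (ideal_congr h); rewrite exprS; ring.
case: hU => a' _ h'; apply: (sop_upd sw) => //.
exists (n + r).+1; exists (x * a') => //.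
by apply: (ideal_congr (h' : J _)); rewrite -/x exprS; ring.
Qed.

(** For [M] large, [z = p + x^M] can replace [x] as a parameter. A power of [p] lies in [(x) + J],
    so some power of [z] multiplies [c] into [J]. By [quo_exp] for [z], already [z c] is in [J], and
    [p c] differs from it by a multiple of [x c]. *)
Lemma quo_colon w i c p : sop m w -> sp (predC1 i) w (w i * c) -> m p ->
  sp (predC1 i) w (p * c).
Proof.
move=> sw; set x := w i; set J := sp _ _ => hc mp.
have iJ : is_ideal J := ideal_J w i.
have mx : m x by apply: sop_mem.
have im := max_ideal localA.
have [|M0 hM] := @nzd_family (quo J x) x p (quo_ideal _ iJ) mx.
  by move=> a ha _; apply: (quo_exp_nzd (n := 1)) => //; rewrite expr1.
pose z := p + x ^+ M0.+1.
have mz : m z by apply: idealD => //; rewrite exprS; apply: idealMr.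
have sz : sop m (upd w i z) by apply: sop_upd_nzd => //; apply: hM.
have [n hn] : rad (quo J c) z.
  have ir : is_ideal (rad (quo J c)) by apply: rad_ideal; apply: quo_ideal.
  have xr : rad (quo J c) x by apply: sub_rad; rewrite /quo /= mulrC.
  apply: idealD => //; last by rewrite exprS; apply: idealMr.
  have [_ /(_ p mp) [k]] := sw; rewrite (sp_adjT w i) -/J -/x => -[a _ ha].
  apply: (@rad_exp _ _ p k).
  apply: (ideal_congr (idealD ir (sub_rad (sub_quo c iJ ha)) (idealMr a ir xr))).
  by ring.
have := @quo_exp (upd w i z) i n c sz; rewrite upd_i sp_upd /= ?eqxx // -/J.
rewrite mulrC => /(_ hn) hz.
apply: (ideal_congr (idealB iJ hz (idealM (x ^+ M0) iJ hc))).
by rewrite /z exprS; ring.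
Qed.

Lemma sp_colon w (P : pred 'I_d) i n c : sop m w -> ~~ P i ->
  sp P w (w i ^+ n * c) -> ideal_colon (sp P w) m c.
Proof.
move=> sw nPi hc p mp.
apply: (krull_inter noethA localA (P := predC P) (w := w)) => [||N].
- exact: sp_ideal.
- by move=> k _; apply: sop_mem.
(* The exponent serves three purposes: [v i] is a multiple of [w i ^+ n], the entries outside [P]
   fall into the ideal of the [N]-th powers, and being positive it keeps them in [m]. *)
pose N' := (N + n).+1.
pose v k := if P k then w k else w k ^+ N'.
have sv : sop m v.
  apply: (sop_trans sw) => k; rewrite /v.
    case: ifP => _; first exact: sop_mem.
    by rewrite exprS; apply: idealMr; [exact: max_ideal localA|exact: sop_mem].
  case: (boolP (P k)) => Pk.
    by apply: sub_rad; have := @sp_mem _ _ predT v k isT; rewrite /v Pk.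
  by exists N'; have := @sp_mem _ _ predT v k isT; rewrite {2}/v (negPf Pk).
have spv : sp P v = sp P w by apply: eq_sp => k Pk; rewrite /v Pk.
have h1 : sp (predC1 i) v (v i * c).
  have PC : {subset P <= predC1 i}.
    by move=> k Pk; apply: contraNneq nPi => <-.
  apply: (spS PC); rewrite spv /v (negPf nPi).
  have -> : N' = (N.+1 + n)%N by rewrite /N'; lia.
  by rewrite exprD -mulrA; apply: idealM => //; apply: sp_ideal.
have := quo_colon sv h1 mp.
have : sp (predC1 i) v `<=` lin 1 (sp (predC P) (fun k => w k ^+ N)) (sp P w).
  apply: sp_sub => [|k _]; first by apply: lin_ideal; apply: sp_ideal.
  rewrite /v; case: ifP => Pk.
    by apply: sub_linr; [exact: sp_ideal|exact: sp_mem].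
  have -> : N' = (n.+1 + N)%N by rewrite /N'; lia.
  exists (w k ^+ (n.+1 + N)); last by rewrite mul1r subrr; apply: ideal0; apply: sp_ideal.
  rewrite exprD; apply: idealM; first exact: sp_ideal.
  by apply: (sp_mem (fun k => w k ^+ N)); rewrite /= Pk.
by move=> h /h; rewrite mulrC.
Qed.

(** The element is [w' i + w i ^+ M]. Modulo the colon ideal of [w] the entry [w i] is a
    nonzerodivisor, modulo that of [w'] the entry [w' i] is; [nzd_family] covers both cases, and one
    [M] beyond both bounds serves for both. *)
Lemma sop_common w w' i : sop m w -> sop m w' ->
  exists z, sop m (upd w i z) /\ sop m (upd w' i z).
Proof.
move=> sw sw'; have iW v := quo_ideal (v i) (ideal_J v i).
have mx := sop_mem i sw; have my := sop_mem i sw'.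
have [|M0 h0] := @nzd_family _ (w i) (w' i) (iW w) mx.
  by move=> c h _; apply: (quo_exp_nzd (n := 1)) => //; rewrite expr1.
have [|M1 h1] := @nzd_family _ (w i) (w' i) (iW w') mx.
  by move=> c _ h; apply: (quo_exp_nzd (n := 1)) => //; rewrite expr1.
have mz : m (w' i + w i ^+ (M0 + M1).+1).
  have im := max_ideal localA.
  by apply: idealD => //; rewrite exprS; apply: idealMr.
exists (w' i + w i ^+ (M0 + M1).+1); split; apply: sop_upd_nzd => //.
  by apply: h0; lia.
by apply: h1; lia.
Qed.

(** Induction on the number of leading entries in which the systems may differ: replacing the last
    of these by a common [z] in both systems removes one difference. *)
Lemma sop_connected (F : ('I_d -> A) -> nat) :
  (forall w i x, sop m w -> sop m (upd w i x) -> F w = F (upd w i x)) ->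
  forall w w', sop m w -> sop m w' -> F w = F w'.
Proof.
move=> hF w w' sw sw'.
suff : forall n w w', sop m w -> sop m w' ->
    (forall k : 'I_d, (n <= k)%N -> w k = w' k) -> F w = F w'.
  by move/(_ d); apply=> // k; rewrite leqNgt ltn_ord.
elim=> [|n IHn] {sw sw'} {}w {}w' sw sw' e.
  by congr F; apply/funext => k; apply: e.
case: (ltnP n d) => hn; last first.
  by apply: IHn => // k hk; have := ltn_ord k; lia.
pose i := Ordinal hn; have [z [sz sz']] := sop_common i sw sw'.
rewrite (hF w i z) // (hF w' i z) //; apply: IHn => // k hk.
rewrite /upd; case: eqP => // /eqP ki; apply: e.
by move: ki hk; rewrite -val_eqE /=; lia.
Qed.

End WeakSequences.

(** * The index of reducibility *)

Section IndexOfReducibility.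
Variables (A : comNzRingType) (m : set A).
Hypotheses (noethA : is_noetherian A) (localA : is_local_ring m).
Variable d : nat.
Implicit Types (I J K L : set A) (x y z a b c p : A).
Implicit Types (w v : 'I_d -> A) (i j : 'I_d) (P : pred 'I_d).

Hypothesis weak_seq : forall w P i n c, sop m w -> ~~ P i ->
  sp P w (w i ^+ n * c) -> ideal_colon (sp P w) m c.

Notation "I :m" := (ideal_colon I m) (at level 2, format "I :m").

Let ideal_colon_sp P w : is_ideal (sp P w):m := colon_ideal m (sp_ideal P w).

Lemma weak_seq1 w P i c : sop m w -> ~~ P i ->
  sp P w (w i * c) -> (sp P w):m c.
Proof. by move=> sw nPi h; apply: (weak_seq (n := 1) sw nPi); rewrite expr1. Qed.

Lemma weak_seq_colon w P i c : sop m w -> ~~ P i ->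
  (sp P w):m:m c -> (sp P w):m c.
Proof.
move=> sw nPi hc; apply: (weak_seq (n := 2) sw nPi).
have [mw _] := sw.
have h : sp P w (c * w i * w i) := hc _ (mw i) _ (mw i).
by apply: (ideal_congr h); ring.
Qed.

Lemma weak_seq_nzd w P i c : sop m w -> ~~ P i ->
  (sp P w):m (w i * c) -> (sp P w):m c.
Proof.
move=> sw nPi hc; apply: (weak_seq (n := 2) sw nPi).
have [mw _] := sw.
have h : sp P w (w i * c * w i) := hc _ (mw i).
by apply: (ideal_congr h); ring.
Qed.

(* limclos predT w is U(w), the limit closure of the parameter ideal (w). *)
Definition limclos P w : set A :=
  ideal_gen [set s | sp predT w s \/ exists2 i, P i & (sp (predC1 i) w):m s].

Lemma limclos_ideal P w : is_ideal (limclos P w). Proof. exact: ideal_gen_ideal. Qed.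

Lemma sub_limclos P w : sp predT w `<=` limclos P w.
Proof. by move=> s h; apply: sub_ideal_gen; left. Qed.

Lemma colon_limclos P w i : P i -> (sp (predC1 i) w):m `<=` limclos P w.
Proof. by move=> Pi s h; apply: sub_ideal_gen; right; exists i. Qed.

Lemma limclos_sub P w K : is_ideal K -> sp predT w `<=` K ->
  (forall i, P i -> (sp (predC1 i) w):m `<=` K) -> limclos P w `<=` K.
Proof.
move=> iK h1 h2; apply: ideal_gen_sub => // s [/h1//|[i Pi]]; exact: h2.
Qed.

Lemma limclos_colon P w : limclos P w `<=` (sp predT w):m.
Proof.
apply: limclos_sub => //; first by apply: sub_colon; apply: sp_ideal.
by move=> i _; apply: colonS; apply: spS.
Qed.

Lemma sp_pred2 w i j P : j != i -> P =1 predC1 j ->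
  sp P w = adj (w i) (sp [pred k | k != j & k != i] w).
Proof.
move=> ji eP; rewrite (@adj_sp _ _ P w i); last by rewrite eP /= eq_sym.
by congr adj; congr sp; apply/funext => k /=; rewrite eP.
Qed.

(** This inverts multiplication by [t]. With [x = w i], write [e x = x t f] modulo [K]; then
    [x (e - t f)] is in [K], so [e - t f] is in [K : m]. For [p] in [m], [e p = x t h] modulo [K],
    and cancelling [t] puts [f p - x h] in [K : m]; thus [m^2 f] lies in [(x) + K], which suffices
    by [weak_seq_colon]. *)
Lemma colon_divide w i j t e : sop m w -> j != i ->
  let K := sp [pred k | k != j & k != i] w in
  (forall c, K (t * c) -> K:m c) ->
  (adj (w i * t) K):m e ->
  exists2 f, (sp (predC1 j) w):m f & K:m (e - t * f).
Proof.
move=> sw ji K tK he; have iK : is_ideal K by apply: sp_ideal.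
have [mw _] := sw; set x := w i.
have [f _ hf] := he _ (mw i).
have ne : ~~ [pred k | k != j & k != i] i by rewrite /= eqxx andbF.
have hg : K:m (e - t * f).
  by apply: (weak_seq1 sw ne); apply: (ideal_congr hf); ring.
exists f => //; apply: (weak_seq_colon sw (i := j)); first by rewrite /= eqxx.
move=> p mp q mq; rewrite (sp_pred2 w ji) // -/K -/x.
have [h _ hh] := he _ mp.
have hg' := hg _ mp.
have /(_ q mq) : K:m (f * p - x * h).
  by apply: tK; apply: (ideal_congr (idealB iK hh hg')); rewrite -/x; ring.
by move=> hq; exists (h * q) => //; apply: (ideal_congr hq); ring.
Qed.

(** With [W = J : m], the inclusion induces an isomorphism from [W / J] to [((x) + W) / ((x) + J)]:
    if [x b + j] is in [W] with [j] in [J], then [b] is in [W] by [weak_seq_nzd], so [x b] is in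
    [J]. The length therefore depends on [J] alone. *)
Lemma len_colon_adj w i : sop m w -> let J := sp (predC1 i) w in
  len (adj (w i) J:m) (sp predT w) = len J:m J.
Proof.
move=> sw J; set x := w i; set W := J:m.
have iJ : is_ideal J by apply: sp_ideal.
have iW : is_ideal W by apply: colon_ideal.
have JW : J `<=` W by apply: sub_colon.
have mx : m x := proj1 sw i.
have ni : ~~ predC1 i i by rewrite /= eqxx.
symmetry; rewrite (sp_adjT w i) -/x -/J.
have ia : is_ideal (adj x J) by apply: adj_ideal.
have f : finl setT (adj x J).
  by apply: (sop_finl noethA localA sw) => //; rewrite (sp_adjT w i).
apply: (len_mul (x := 1) iJ iW JW (adj_ideal x iW) ia); rewrite ?/adj.
- exact: linS.
- by move=> a Wa; rewrite mul1r; apply: sub_adj.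
- move=> a Wa; rewrite mul1r => -[b _ h].
  have Wb : W b.
    apply: (weak_seq_nzd sw ni); rewrite -/J -/W -/x.
    by apply: (ideal_congr (idealB iW Wa (JW _ h))); ring.
  by apply: (ideal_congr (idealD iJ h (Wb _ mx))); ring.
- by move=> a Ja; rewrite mul1r; apply: sub_adj.
- move=> z [b _ h]; exists (z - x * b) => //.
  by exists b => //; apply: (ideal_congr (ideal0 iJ)); ring.
- exact: finlS f.
Qed.

Section Swap.
Variables (w : 'I_d -> A) (i : 'I_d).
Hypothesis sw : sop m w.
Let x := w i.
Let J := sp (predC1 i) w.
Let W := J:m.

Let iJ : is_ideal J. Proof. exact: sp_ideal. Qed.
Let iW : is_ideal W. Proof. exact: colon_ideal. Qed.
Let JW : J `<=` W. Proof. exact: sub_colon. Qed.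
Let mx : m x := proj1 sw i.
Let ni : ~~ predC1 i i. Proof. by rewrite /= eqxx. Qed.

(** The ideal [(x) + W] splits the length. The lower part is given by [len_colon_adj] and is the
    same for [x] and [x y]; the upper parts correspond under multiplication by [y], whose
    surjectivity is [colon_divide] with [t = y]. *)
Lemma len_limclos_swap y : sop m (upd w i y) ->
  len (limclos predT w) (sp predT w) =
  len (limclos predT (upd w i (x * y))) (sp predT (upd w i (x * y))).
Proof.
move=> sy; set w' := upd w i (x * y).
have [my _] := sy; have {}my : m y by have := my i; rewrite upd_i.
have sw' : sop m w'.
  apply: (sop_upd sw); first exact: idealMr (max_ideal localA) mx.
  have [_ /(_ _ mx) [n hn]] := sy; exists n.+1.
  move: hn; rewrite sp_updT -/J => -[a _ h]; exists a => //.
  by apply: (ideal_congr (idealM x iJ h)); rewrite -/x exprS; ring.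
have J' : sp (predC1 i) w' = J by rewrite sp_upd.
have w'i : w' i = x * y by rewrite /w' upd_i.
have x_nzd c : W (x * c) -> W c by apply: weak_seq_nzd.
have y_nzd c : W (y * c) -> W c.
  by have := @weak_seq_nzd (upd w i y) (predC1 i) i c sy ni; rewrite upd_i sp_upd.
have TU v : sop m v -> sp (predC1 i) v = J -> [/\ sp predT v `<=` adj (v i) W,
    adj (v i) W `<=` limclos predT v & finl setT (sp predT v)].
  move=> sv Jv; split.
  - by rewrite (sp_adjT v i) Jv; apply: adjS.
  - apply: adj_sub; first exact: limclos_ideal.
      by apply: sub_limclos; apply: sp_mem.
    by rewrite /W -Jv; apply: colon_limclos.
  - by apply: (sop_finl noethA localA sv) => //; apply: sp_ideal.
have [s1 s2 f] := TU w sw erefl; have [s1' s2' f'] := TU w' sw' J'.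
have ff : finl (limclos predT w) (sp predT w) by apply: finlS f.
have ff' : finl (limclos predT w') (sp predT w') by apply: finlS f'.
rewrite (len_add (sp_ideal _ _) (adj_ideal x iW) (limclos_ideal _ _) s1 s2 ff).
rewrite w'i in s1' s2'.
rewrite (len_add (sp_ideal _ _) (adj_ideal (x * y) iW) (limclos_ideal _ _) s1' s2' ff').
have -> : len (adj (x * y) W) (sp predT w') = len (adj x W) (sp predT w).
  by have := len_colon_adj i sw'; rewrite /= w'i J' => ->; rewrite len_colon_adj.
congr (_ + _)%N.
have yP P : sp P w `<=` quo (sp P w') y.
  apply: sp_sub => [|k Pk]; first by apply: quo_ideal; apply: sp_ideal.
  rewrite /quo /=; case: (eqVneq k i) => [ki|ki].
    by rewrite ki -/x mulrC -w'i -ki; apply: sp_mem.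
  by rewrite -(upd_ne w (x * y) ki); apply: idealM; [exact: sp_ideal|exact: sp_mem].
apply: (len_mul (x := y) (adj_ideal x iW) (limclos_ideal _ _) s2
  (limclos_ideal _ _) (adj_ideal _ iW) s2').
- suff : limclos predT w `<=` quo (limclos predT w') y by [].
  apply: limclos_sub; first by apply: quo_ideal; apply: limclos_ideal.
    by move=> s /yP h; apply: sub_limclos.
  move=> j _ c hc; apply: (colon_limclos (i := j)) => // p mp.
  by have := yP _ _ (hc p mp); rewrite /quo /= mulrA.
- move=> a _ [b _ h]; exists b => //; apply: y_nzd.
  by apply: (ideal_congr h); ring.
- move=> a [b _ h]; exists b => //.
  by apply: (ideal_congr (idealM y iW h)); ring.
- have il : is_ideal (lin y (limclos predT w) (adj (x * y) W)).
    by apply: lin_ideal; [exact: limclos_ideal|exact: adj_ideal].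
  apply: limclos_sub => //.
    by apply: subset_trans s1' _; apply: sub_linr; exact: limclos_ideal.
  move=> j _; case: (eqVneq j i) => [->|ji].
    rewrite J'; apply: subset_trans (sub_linr _ (limclos_ideal _ _)).
    exact: sub_adj.
  move=> e; rewrite (sp_pred2 w' ji) // w'i.
  set K := sp _ w'.
  have KE : K = sp [pred k | k != j & k != i] w by rewrite /K sp_upd //= eqxx andbF.
  rewrite KE => /(colon_divide sw ji) [|f0 hf hK].
    move=> c; have := @weak_seq1 (upd w i y) [pred k | k != j & k != i] i c sy.
    by rewrite upd_i sp_upd /= ?eqxx ?andbF //; apply.
  exists f0; first exact: colon_limclos hf.
  apply: sub_adj; apply: colonS hK; apply: spS => k /andP[] //.
- by apply: finlS f'.
Qed.

(** The ideal [(x^n) + W] cuts off a part of length [len W J]; on the remaining quotient,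
    multiplication by [x^(n-2)] is an isomorphism from exponent 2 to exponent [n]. *)
Lemma len_colon_pow n : (1 < n)%N ->
  len (sp predT (upd w i (x ^+ n))):m (sp predT (upd w i (x ^+ n))) =
  (len W J + len (adj (x ^+ 2) J):m (adj (x ^+ 2) W))%N.
Proof.
move=> n1; have im := max_ideal localA.
have x_nzd k c : W (x ^+ k * c) -> W c.
  elim: k => [|k IHk]; first by rewrite mul1r.
  rewrite exprS -mulrA => /(weak_seq_nzd sw ni); exact: IHk.
have mxn k : (0 < k)%N -> m (x ^+ k).
  by case: k => // k _; rewrite exprS; apply: idealMr.
have swn k : (0 < k)%N -> sop m (upd w i (x ^+ k)).
  move=> k0; apply: (sop_upd sw); first exact: mxn.
  by exists k; apply: adj_id.
have iA k : is_ideal (adj (x ^+ k) J) by apply: adj_ideal.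
have iC k : is_ideal (adj (x ^+ k) J):m by apply: colon_ideal.
have AW k : adj (x ^+ k) J `<=` adj (x ^+ k) W by apply: adjS.
have WC k : adj (x ^+ k) W `<=` (adj (x ^+ k) J):m.
  apply: adj_sub => //.
    by move=> p mp; apply: adj_mul.
  by apply: colonS; apply: sub_adj.
have fA k : (0 < k)%N -> finl setT (adj (x ^+ k) J).
  move=> k0; apply: (sop_finl noethA localA (swn k k0)) => //.
  by rewrite sp_updT.
have n0 : (0 < n)%N by apply: ltnW.
have eJ : sp (predC1 i) (upd w i (x ^+ n)) = J by rewrite sp_upd.
have := len_colon_adj i (swn n n0); rewrite /= upd_i eJ !sp_updT -/J -/W => <-.
rewrite (len_add (iA n) (adj_ideal _ iW) (iC n) (AW n) (WC n)); last exact: finlS (fA n n0).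
have En2 : x ^+ n = x ^+ (n - 2) * x ^+ 2 by rewrite -exprD subnK.
rewrite addnC; congr (_ + _)%N; symmetry.
apply: (len_mul (x := x ^+ (n - 2)) (adj_ideal _ iW) (iC 2%N) (WC 2%N) (iC n)
  (adj_ideal _ iW) (WC n)).
- move=> a ha p mp; have [b _ h] := ha p mp; exists b => //.
  apply: (ideal_congr (idealM (x ^+ (n - 2)) iJ h)).
  by rewrite En2; ring.
- move=> a _ [b _ h]; exists b => //; apply: (x_nzd (n - 2)%N).
  by apply: (ideal_congr h); rewrite En2; ring.
- move=> a [b _ h]; exists b => //.
  apply: (ideal_congr (idealM (x ^+ (n - 2)) iW h)).
  by rewrite En2; ring.
- move=> e he; have [f _ hf] := he x mx.
  have En : x ^+ n = x ^+ (n - 2) * x * x by rewrite -mulrA -expr2 -exprD subnK.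
  have hg : W (e - x ^+ (n - 2) * (x * f)).
    by apply: (weak_seq1 sw ni); apply: (ideal_congr hf); rewrite -/x En; ring.
  exists (x * f); last exact: sub_adj.
  move=> p mp; have [h _ hh] := he p mp.
  have : W (f * p - x * h).
    apply: (x_nzd (n - 2).+1).
    apply: (ideal_congr (idealB iW (JW hh) (idealMr p iW hg))).
    by rewrite En exprSr; ring.
  by move=> /(_ x mx) h2; exists h => //; apply: (ideal_congr h2); ring.
- exact: finlS (fA n n0).
Qed.

End Swap.

Notation reducibility w := (len (sp predT w):m (sp predT w)).

Lemma reducibility_pow w n : sop m w -> (1 < n)%N ->
  reducibility (fun k => w k ^+ n) = reducibility (fun k => w k ^+ 2).
Proof.
move=> sw n1.
pose g (j : nat) (k : 'I_d) := w k ^+ (if (k < j)%N then n else 2).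
have step (j : nat) : (j <= d)%N -> reducibility (g j) = reducibility (g 0%N).
  elim: j => [//|j IHj] hj; rewrite -(IHj (ltnW hj)).
  pose i := Ordinal hj; pose v := upd (g j) i (w i).
  have vi : v i = w i by rewrite /v upd_i.
  have sv : sop m v.
    apply: (sop_trans sw) => k.
      rewrite /v /upd /g; case: eqP => _; first by case: sw.
      have -> : (if (k < j)%N then n else 2) = (if (k < j)%N then n else 2).-1.+1.
        by case: ifP => _; lia.
      by rewrite exprS; apply: idealMr; [exact: max_ideal localA|case: sw].
    case: (eqVneq k i) => [->|ki]; first by apply: sub_rad; rewrite -vi; apply: sp_mem.
    exists (if (k < j)%N then n else 2).
    have -> : w k ^+ (if (k < j)%N then n else 2) = v k by rewrite /v upd_ne.
    exact: sp_mem.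
  have e1 : g j.+1 = upd v i (v i ^+ n).
    apply/funext => k; rewrite /v upd_upd upd_i /upd /g.
    case: eqP => [->|/eqP ki] /=; first by rewrite ltnSn.
    by rewrite ltnS leq_eqVlt -[_ == j]/(k == i) (negPf ki).
  have e2 : g j = upd v i (v i ^+ 2).
    apply/funext => k; rewrite /v upd_upd upd_i /upd /g.
    by case: eqP => [->|//] /=; rewrite ltnn.
  by rewrite e1 e2 !(len_colon_pow i sv).
have -> : (fun k => w k ^+ n) = g d by apply/funext => k; rewrite /g ltn_ord.
by rewrite step.
Qed.

Lemma cramer_ideal K (a : 'M[A]_d) w : is_ideal K ->
  (forall i, K (\sum_j a i j * w j)) -> forall j, K (\det a * w j).
Proof.
move=> iK h j; pose u : 'cV[A]_d := \col_j w j.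
have -> : \det a * w j = (\adj a *m (a *m u)) j ord0.
  by rewrite mulmxA mul_adj_mx mul_scalar_mx !mxE.
rewrite mxE; apply: ideal_sum => // i _; apply: idealM => //.
rewrite mxE; apply: (ideal_congr (h i)).
by apply: eq_bigr => k _; rewrite !mxE.
Qed.

(* Change one row at a time: the difference matrix D sends w to a vector
   vanishing at i0, so Cramer's rule puts det D into (v_k, k != i0) : (w). *)
Lemma limclos_det_diff (a b : 'M[A]_d) w v : sop m v ->
  (forall i, v i = \sum_j a i j * w j) -> (forall i, v i = \sum_j b i j * w j) ->
  limclos predT v (\det a - \det b).
Proof.
move=> sv ha hb.
pose h n : 'M[A]_d := \matrix_(i, j) if (i < n)%N then b i j else a i j.
have hv n i : v i = \sum_j h n i j * w j.
  by case hin : (i < n)%N; [rewrite hb|rewrite ha]; apply: eq_bigr => j _; rewrite mxE hin.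
have step n : (n <= d)%N -> limclos predT v (\det a - \det (h n)).
  elim: n => [_|n IHn hn].
    have -> : h 0%N = a by apply/matrixP => i j; rewrite mxE.
    by rewrite subrr; apply: ideal0; apply: limclos_ideal.
  pose i0 := Ordinal hn.
  have i0n : (i0 < n)%N = false by rewrite /= ltnn.
  have i0n' : (i0 < n.+1)%N by rewrite /=.
  have lin0 (i : 'I_d.-1) : (lift i0 i < n.+1)%N = (lift i0 i < n)%N.
    have := neq_lift i0 i; rewrite ltnS leq_eqVlt -val_eqE /= eq_sym => /negPf ->.
    by [].
  pose D : 'M[A]_d := \matrix_(i, j) if i == i0 then a i j - b i j else h n i j.
  have detD : \det D = 1 * \det (h n) + (- 1) * \det (h n.+1).
    apply: (determinant_multilinear (i0 := i0)).
    - by apply/rowP => j; rewrite !mxE eqxx i0n i0n'; ring.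
    - by apply/matrixP => i j; rewrite !mxE eq_sym (negPf (neq_lift _ _)).
    - by apply/matrixP => i j; rewrite !mxE eq_sym (negPf (neq_lift _ _)) lin0.
  have iK := @sp_ideal A d (predC1 i0) v.
  have KD : forall j, sp (predC1 i0) v (\det D * w j).
    apply: cramer_ideal => // i; case: (eqVneq i i0) => [->|ii0].
      have -> : \sum_j D i0 j * w j = 0.
        transitivity (v i0 - v i0); last exact: subrr.
        rewrite {1}ha hb -sumrB; apply: eq_bigr => j _.
        by rewrite mxE eqxx mulrBl.
      exact: ideal0.
    have -> : \sum_j D i j * w j = v i.
      by rewrite [RHS](hv n i); apply: eq_bigr => j _; rewrite !mxE (negPf ii0).
    exact: sp_mem.
  have hD : limclos predT v (\det D).
    apply: (@colon_limclos predT v i0) => //; apply: (weak_seq1 sv (i := i0)).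
      by rewrite /= eqxx.
    rewrite mulrC ha mulr_sumr; apply: ideal_sum => // j _.
    by apply: (ideal_congr (idealM (a i0 j) iK (KD j))); ring.
  apply: (ideal_congr (idealD (limclos_ideal _ _) (IHn (ltnW hn)) hD)).
  by rewrite detD; ring.
have <- : h d = b by apply/matrixP => i j; rewrite mxE ltn_ord.
exact: step.
Qed.

(** If [w_i t] is in [(w_k, k != i)], multiplying by the other entries turns each generator [w_k]
    into a multiple of [w_k^2]. Together with [limclos_clear] this identifies [U(w)], for a system
    of parameters, with the usual limit closure, the union of the [(w^n) : (prod w)^(n-1)] over
    [n >= 1]. *)
Lemma limclos_prod w P t : (forall i, m (w i)) -> limclos P w t ->
  sp predT (fun k => w k ^+ 2) ((\prod_k w k) * t).
Proof.
move=> mw; move: t; suff : limclos P w `<=` quo (sp predT (fun k => w k ^+ 2)) (\prod_k w k) by [].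
have iS := @sp_ideal A d predT (fun k => w k ^+ 2).
have sub (Q : pred 'I_d) : sp Q w `<=` quo (sp predT (fun k => w k ^+ 2)) (\prod_(k | Q k) w k).
  apply: sp_sub => [|k Qk]; first exact: quo_ideal.
  rewrite /quo /= (bigD1 k) //=.
  have h := sp_mem (fun k => w k ^+ 2) (isT : predT k).
  by apply: (ideal_congr (idealM (\prod_(i | Q i && (i != k)) w i) iS h)); ring.
apply: limclos_sub => [||i _ t ht]; first exact: quo_ideal.
  exact: sub.
have := sub _ _ (ht _ (mw i)); rewrite /quo /= => h.
by rewrite (bigD1 i) //=; apply: (ideal_congr h); ring.
Qed.

Lemma limclosS P Q w : {subset P <= Q} -> limclos P w `<=` limclos Q w.
Proof.
move=> PQ; apply: limclos_sub => [||i Pi]; [exact: limclos_ideal|exact: sub_limclos|].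
by apply: colon_limclos; apply: PQ.
Qed.

Lemma limclos_divide w P i n s : sop m w -> ~~ P i -> (0 < n)%N ->
  limclos P (upd w i (w i ^+ n)) (w i ^+ n.-1 * s) -> limclos [pred k | P k || (k == i)] w s.
Proof.
move=> sw nPi n0; set x := w i; set K := sp (predC1 i) w; set Q := [pred k | _].
have ni : ~~ predC1 i i by rewrite /= eqxx.
have iK : is_ideal K by apply: sp_ideal.
have iW : is_ideal K:m by apply: colon_ideal.
have En : x ^+ n = x * x ^+ n.-1 by rewrite -exprS prednK.
have Qi : Q i by rewrite /Q /= eqxx orbT.
have sub : limclos P (upd w i (x ^+ n)) `<=` lin (x ^+ n.-1) (limclos Q w) K:m.
  apply: limclos_sub.
  - by apply: lin_ideal => //; apply: limclos_ideal.
  - rewrite sp_updT -/K; apply: adj_sub; first by apply: lin_ideal => //; apply: limclos_ideal.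
      rewrite En mulrC; apply: lin_mul => //.
      by apply: sub_limclos; apply: sp_mem.
    by apply: subset_trans (sub_colon iK) _; apply: sub_linr; apply: limclos_ideal.
  - move=> j Pj e; have ji : j != i by apply: contraNneq nPi => <-.
    rewrite (sp_pred2 (upd w i (x ^+ n)) ji) // upd_i sp_upd; last by rewrite /= eqxx andbF.
    rewrite En => /(colon_divide sw ji) [|f hf hK].
      move=> c; by apply: (weak_seq sw); rewrite /= eqxx andbF.
    exists f; first by apply: colon_limclos hf; rewrite /Q /= Pj.
    by apply: colonS hK; apply: spS => k /andP[].
move/sub => [f Uf h].
have : K:m (s - f).
  apply: (weak_seq (n := n) sw ni).
  apply: (ideal_congr (h _ (proj1 sw i))).
  by rewrite -/x En; ring.
move/(colon_limclos Qi) => h2.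
by apply: (ideal_congr (idealD (limclos_ideal _ _) h2 Uf)); ring.
Qed.

(** The entries are lowered to exponent 1 one at a time; the predicate in [limclos] records those
    already lowered. *)
Lemma limclos_clear w n s : sop m w -> (0 < n)%N ->
  sp predT (fun k => w k ^+ n) ((\prod_k w k) ^+ n.-1 * s) -> limclos predT w s.
Proof.
move=> sw n0 hs; have im := max_ideal localA.
pose g (j : nat) (k : 'I_d) := if (k < j)%N then w k else w k ^+ n.
have sg (j : nat) : sop m (g j).
  apply: (sop_trans sw) => k.
    rewrite /g; case: ifP => _; first by case: sw.
    by rewrite -[n]prednK // exprS; apply: idealMr => //; case: sw.
  have := @sp_mem _ _ predT (g j) k isT; rewrite {2}/g; case: ifP => _ h.
    exact: sub_rad.
  by exists n.
suff step (j : nat) : (j <= d)%N ->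
    limclos [pred k : 'I_d | (k < j)%N] (g j) ((\prod_(k < d | (j <= k)%N) w k) ^+ n.-1 * s).
  have := step d (leqnn d); rewrite big1 => [|k]; last by rewrite leqNgt ltn_ord.
  rewrite expr1n mul1r.
  have -> : g d = w by apply/funext => k; rewrite /g ltn_ord.
  exact: limclosS.
elim: j => [_|j IHj hj].
  have -> : g 0%N = (fun k => w k ^+ n) by apply/funext.
  by apply: sub_limclos; apply: (ideal_congr hs).
pose i := Ordinal hj.
have gi : g j.+1 i = w i by rewrite /g /= ltnSn.
have gu : g j = upd (g j.+1) i (g j.+1 i ^+ n).
  apply/funext => k; rewrite gi /upd /g.
  case: eqP => [->|/eqP ki] /=; first by rewrite ltnn.
  by rewrite ltnS [in RHS]leq_eqVlt -[_ == j]/(k == i) (negPf ki).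
have := IHj (ltnW hj); rewrite gu (bigD1 i) //= exprMn -gi -mulrA.
move/(limclos_divide (sg j.+1)); rewrite /= ltnn => /(_ isT n0).
rewrite (eq_bigl (fun k : 'I_d => (j < k)%N)); last first.
  by move=> k; rewrite [in RHS]ltn_neqAle andbC eq_sym.
apply: limclosS => k; rewrite !inE => /orP[/ltnW//|/eqP -> /=]; exact: leqnn.
Qed.

(** Write [y^n = B z^2] and [D = diag z]; then [det (B D a) t] is in [(y^n)]. Both [B D a] and
    [diag (y^(n-1))] express [y^n] through [y], so their determinants agree modulo [U(y^n)], and
    [(prod y)^(n-1) t] lies in [U(y^n)]. [limclos_prod] and [limclos_clear] bring this back to
    [U(y)]. *)
Lemma limclos_det (y z : 'I_d -> A) (a : 'M[A]_d) t : sop m y -> sop m z ->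
  (forall i, z i = \sum_j a i j * y j) -> limclos predT z (\det a * t) -> limclos predT y t.
Proof.
move=> sy sz hz /(limclos_prod (proj1 sz)); set z2 := fun k => z k ^+ 2 => ht.
have sz2 : sop m z2 by apply: sop_pow.
have ex i : exists n, sp predT z2 (y i ^+ n).
  by have [_ h] := sz2; apply: h; case: sy.
have [f hf] := choice ex.
pose n := (\max_i f i).+1.
have hn i : exists b : 'I_d -> A, y i ^+ n = \sum_j b j * z2 j.
  suff : sp predT z2 (y i ^+ n) by [].
  have /subnK <- : (f i <= n)%N by rewrite /n ltnW // ltnS; exact: leq_bigmax.
  by rewrite exprD; apply: idealM; [exact: sp_ideal|exact: hf].
have [b hb] := choice hn.
pose B : 'M[A]_d := \matrix_(i, j) b i j.
pose D : 'M[A]_d := diag_mx (\row_k z k).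
pose Y : 'M[A]_d := diag_mx (\row_k y k ^+ n.-1).
pose yn k := y k ^+ n.
have syn : sop m yn by apply: sop_pow.
have detD : \det D = \prod_k z k.
  by rewrite det_diag; apply: eq_bigr => k _; rewrite mxE.
have detY : \det Y = (\prod_k y k) ^+ n.-1.
  by rewrite det_diag -prodrXl; apply: eq_bigr => k _; rewrite mxE.
have h1 : sp predT yn (\det (B *m (D *m a)) * t).
  rewrite !det_mulmx detD -!mulrA.
  suff : sp predT z2 `<=` quo (sp predT yn) (\det B) by apply.
  apply: sp_sub => [|k _]; first by apply: quo_ideal; apply: sp_ideal.
  rewrite /quo /=; apply: cramer_ideal => [|i]; first exact: sp_ideal.
  have -> : \sum_j B i j * z2 j = yn i.
    by rewrite /yn hb; apply: eq_bigr => j _; rewrite mxE.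
  exact: sp_mem.
have e1 i : yn i = \sum_j (B *m (D *m a)) i j * y j.
  rewrite /yn hb; under [RHS]eq_bigr do rewrite mxE mulr_suml.
  rewrite exchange_big /=; apply: eq_bigr => j _.
  rewrite /z2 expr2 {2}hz !mulr_sumr; apply: eq_bigr => k _.
  by rewrite mul_diag_mx !mxE; ring.
have e2 i : yn i = \sum_j Y i j * y j.
  rewrite (bigD1 i) //= big1 ?addr0 => [|j /negPf ji].
    by rewrite !mxE eqxx mulr1n /yn -exprSr.
  by rewrite !mxE eq_sym ji mulr0n mul0r.
have h2 : limclos predT yn ((\prod_k y k) ^+ n.-1 * t).
  have := idealMr t (limclos_ideal _ _) (limclos_det_diff syn e1 e2).
  rewrite detY => h; have h1' := sub_limclos (P := predT) h1.
  by apply: (ideal_congr (idealB (limclos_ideal _ _) h1' h)); ring.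
(* Multiplication by the product of the [y k ^+ n] raises [(prod y)^(n-1)] to the exponent [2n - 1]
   that [limclos_clear] expects for [y^(2n)]. *)
apply: (limclos_clear (n := (n * 2)%N) sy) => //.
have := limclos_prod (proj1 syn) h2.
have -> : (fun k => yn k ^+ 2) = (fun k => y k ^+ (n * 2)).
  by apply/funext => k; rewrite /yn -exprM.
rewrite /yn prodrXl mulrA -exprD.
by have -> : (n + n.-1 = (n * 2).-1)%N by rewrite /n; lia.
Qed.

Hypothesis connected : forall F : ('I_d -> A) -> nat,
  (forall w i x, sop m w -> sop m (upd w i x) -> F w = F (upd w i x)) ->
  forall w w', sop m w -> sop m w' -> F w = F w'.

Lemma len_limclos_const w w' : sop m w -> sop m w' ->
  len (limclos predT w) (sp predT w) = len (limclos predT w') (sp predT w').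
Proof.
apply: (connected (F := fun w => len (limclos predT w) (sp predT w))) => {}w i x sw sx.
rewrite (len_limclos_swap sw sx).
have sx' : sop m (upd (upd w i x) i (w i)) by rewrite upd_upd upd_id.
by have := len_limclos_swap sx sx'; rewrite upd_i upd_upd mulrC => ->.
Qed.

Lemma reducibility_le (y z : 'I_d -> A) : sop m y -> sop m z -> sp predT z `<=` sp predT y ->
  (reducibility y <= reducibility z)%N.
Proof.
move=> sy sz zy.
have fin v : sop m v -> finl setT (sp predT v).
  by move=> sv; apply: (sop_finl noethA localA sv) => //; apply: sp_ideal.
have E v : sop m v -> reducibility v =
    (len (sp predT v):m (limclos predT v) + len (limclos predT v) (sp predT v))%N.
  move=> sv; apply: len_add; [exact: sp_ideal|exact: limclos_ideal|by []|
    exact: sub_limclos|exact: limclos_colon|exact: finlS (fin v sv)].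
rewrite !E // (len_limclos_const sy sz) leq_add2r.
have hz i : exists b : 'I_d -> A, z i = \sum_j b j * y j.
  by apply: zy; apply: sp_mem.
have [b hb] := choice hz.
pose a : 'M[A]_d := \matrix_(i, j) b i j.
have ha i : z i = \sum_j a i j * y j.
  by rewrite hb; apply: eq_bigr => j _; rewrite mxE.
apply: (len_mul_le (x := \det a)) => //.
- exact: limclos_ideal.
- exact: limclos_colon.
- exact: limclos_ideal.
- exact: limclos_colon.
- move=> s hs p mp; have := hs _ mp; rewrite -mulrA.
  suff : sp predT y `<=` quo (sp predT z) (\det a) by apply.
  apply: sp_sub => [|k _]; first by apply: quo_ideal; apply: sp_ideal.
  rewrite /quo /=; apply: cramer_ideal => [|i]; first exact: sp_ideal.
  by rewrite -ha; apply: sp_mem.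
- by move=> s _; apply: limclos_det.
- by apply: finlS (fin z sz) => //; exact: sub_limclos.
Qed.

Lemma reducibility_max w (z : 'I_d -> A) : sop m w -> sop m z ->
  (reducibility z <= reducibility (fun k => w k ^+ 2))%N.
Proof.
move=> sw sz.
have ex i : exists n, sp predT z (w i ^+ n).
  by have [_ h] := sz; apply: h; case: sw.
have [f hf] := choice ex.
pose n := (\max_i f i).+2.
rewrite -(reducibility_pow (n := n) sw) //; apply: reducibility_le => //.
  exact: sop_pow.
apply: sp_sub => [|k _]; first exact: sp_ideal.
have /subnK <- : (f k <= n)%N by rewrite /n !leqW //; exact: leq_bigmax.
by rewrite exprD; apply: idealM; [exact: sp_ideal|exact: hf].
Qed.

End IndexOfReducibility.

(** * Sums of monotone functions over exponents *)

Section EventuallyPolynomial.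

(* f agrees for large n with an integral combination of the 'C(n + j, j), j < k *)
Fixpoint epoly k (f : nat -> int) : Prop :=
  if k is k'.+1 then exists c : int, epoly k' (fun n => f n - c * ('C(n + k', k'))%:Z)
  else exists n0, forall n, (n0 <= n)%N -> f n = 0.

Lemma epoly_ext k f g : (exists n0, forall n, (n0 <= n)%N -> f n = g n) ->
  epoly k f -> epoly k g.
Proof.
elim: k f g => [|k IHk] f g [n0 fg] /=.
  move=> [n1 h]; exists (n0 + n1)%N => n hn; rewrite -fg; last by lia.
  by apply: h; lia.
move=> [c hc]; exists c; apply: IHk hc.
by exists n0 => n /fg ->.
Qed.

Lemma epolyD k f g : epoly k f -> epoly k g -> epoly k (fun n => f n + g n).
Proof.
elim: k f g => [|k IHk] f g /=.
  move=> [n0 h0] [n1 h1]; exists (n0 + n1)%N => n hn.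
  by rewrite h0 ?h1 //; lia.
move=> [c hc] [e he]; exists (c + e).
by apply: epoly_ext (IHk _ _ hc he); exists 0%N => n _; ring.
Qed.

Lemma epolyZ k f a : epoly k f -> epoly k (fun n => a * f n).
Proof.
elim: k f => [|k IHk] f /=.
  by move=> [n0 h0]; exists n0 => n hn; rewrite h0 ?mulr0.
move=> [c hc]; exists (a * c).
by apply: epoly_ext (IHk _ hc); exists 0%N => n _; ring.
Qed.

Lemma epolyS k f : epoly k f -> epoly k.+1 f.
Proof.
move=> h; exists 0; apply: epoly_ext h.
by exists 0%N => n _; rewrite mul0r subr0.
Qed.

Lemma epoly0 k : epoly k (fun=> 0).
Proof. by elim: k => [|k IHk]; [exists 0%N|apply: epolyS]. Qed.

Lemma epoly_bin k : epoly k.+1 (fun n => ('C(n + k, k))%:Z).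
Proof.
exists 1; apply: epoly_ext (epoly0 k).
by exists 0%N => n _; rewrite mul1r subrr.
Qed.

Lemma epoly_shift k f : epoly k f -> epoly k (fun n => f n.-1).
Proof.
elim: k f => [|k IHk] f /=.
  by move=> [n0 h0]; exists n0.+1 => n hn; apply: h0; lia.
move=> [c hc]; exists c.
have h : epoly k (fun n => - c * (if k is k'.+1 then ('C(n + k', k'))%:Z else 0)).
  by apply: epolyZ; case: (k) => [|k']; [apply: epoly0|apply: epoly_bin].
apply: epoly_ext (epolyD (IHk _ hc) h).
exists 1%N => -[//|n] _ /=; case: (k) => [|k']; first by rewrite !bin0; ring.
have -> : ('C(n.+1 + k'.+1, k'.+1) = 'C(n + k'.+1, k'.+1) + 'C(n.+1 + k', k'))%N.
  by rewrite addSn binS addSnnS.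
by rewrite PoszD; ring.
Qed.

Lemma epoly_sum k f : epoly k f -> epoly k.+1 (fun n => \sum_(i < n.+1) f i).
Proof.
elim: k f => [|k IHk] f.
  move=> [n0 h0]; exists (\sum_(i < n0) f i); exists n0 => n hn.
  rewrite bin0 mulr1 -(big_mkord xpredT f) -(big_mkord xpredT f).
  rewrite (big_cat_nat (n := n0)) //=; last by lia.
  rewrite [LHS]addrC addKr big1_seq // => i /andP[_].
  by rewrite mem_index_iota => /andP[hi _]; apply: h0.
move=> [c hc]; exists c; apply: epoly_ext (IHk _ hc); exists 0%N => n _.
rewrite sumrB; congr (_ - _); rewrite -mulr_sumr; congr (_ * _).
elim: n => [|n IHn]; first by rewrite big_ord1 !add0n !binn.
by rewrite big_ord_recr /= IHn -PoszD [in RHS]addSn binS addSnnS.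
Qed.

(** When all [h i] coincide, the sum is a partial sum of one function. Otherwise [h 0] is split off,
    and the remaining family, shifted by one, stabilises one index earlier. *)
Lemma epoly_conv k i0 (h : nat -> nat -> int) :
  (forall i, epoly k (h i)) -> (forall i n, (i0 <= i)%N -> h i n = h i0 n) ->
  epoly k.+1 (fun n => \sum_(i < n.+1) h i (n - i)%N).
Proof.
elim: i0 h => [|i0 IHi] h hh hst.
  apply: epoly_ext (epoly_sum (hh 0%N)); exists 0%N => n _.
  rewrite (reindex_inj rev_ord_inj) /=; apply: eq_bigr => i _.
  by rewrite [in RHS]hst // subSS.
have h1 := IHi (fun i => h i.+1) (fun i => hh i.+1) (fun i n hi => hst i.+1 n hi).
apply: epoly_ext (epolyD (epolyS (hh 0%N)) (epoly_shift h1)).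
by exists 1%N => -[//|n] _; rewrite [RHS]big_ord_recl /= subn0; congr (_ + _).
Qed.

Lemma epoly_coefs d f : epoly d.+1 f -> exists (c : 'I_d.+1 -> int) n0,
  forall n, (n0 <= n)%N ->
  f n = \sum_(i < d.+1) (-1) ^+ i * c i * ('C(n + (d - i), d - i))%:Z.
Proof.
elim: d f => [|d IHd] f.
  move=> [c [n0 h]]; exists (fun=> c), n0 => n hn.
  rewrite big_ord1 expr0 mul1r subn0; apply/eqP; rewrite -subr_eq0; apply/eqP.
  exact: h.
move=> [c /IHd[e [n0 h]]].
(* Moving the tail coefficients one place further flips the sign [(-1)^i], hence the negation. *)
exists (fun i => if unlift ord0 i is Some j then - e j else c), n0 => n hn.
rewrite big_ord_recl unlift_none expr0 mul1r subn0.
rewrite -[LHS](subrK (c * ('C(n + d.+1, d.+1))%:Z)) h // addrC; congr (_ + _).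
apply: eq_bigr => i _; rewrite liftK lift0 subSS exprS; ring.
Qed.

End EventuallyPolynomial.

(** * Antitone functions of exponent vectors and their sums in each degree *)

Section MonotoneSums.

Definition noninc d (l : seq nat -> nat) := forall s t, size s = d -> size t = d ->
  (forall i, nth 0 s i <= nth 0 t i)%N -> (l t <= l s)%N.

Lemma noninc_cons d l i : noninc d.+1 l -> noninc d (fun s => l (i :: s)).
Proof.
move=> hl s t ss st hst; apply: hl => /=; rewrite ?ss ?st //.
by case.
Qed.

Lemma noninc_head d l i j s : noninc d.+1 l -> size s = d -> (i <= j)%N ->
  (l (j :: s) <= l (i :: s))%N.
Proof. by move=> hl ss ij; apply: hl => /=; rewrite ?ss // => -[]. Qed.

Lemma box_bounded d N (f : seq nat -> nat) : exists B, forall s, size s = d ->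
  all (fun i => i <= N)%N s -> (f s <= B)%N.
Proof.
elim: d f => [|d IHd] f; first by exists (f [::]) => -[].
have /choice[g hg] : forall i, exists B, forall s, size s = d ->
  all (fun i => i <= N)%N s -> (f (i :: s) <= B)%N by move=> i; apply: IHd.
exists (\max_(i < N.+1) g i)%N => -[//|i s] [ss] /= /andP[iN sN].
apply: leq_trans (hg i s ss sN) _.
by have := @leq_bigmax _ (fun i : 'I_N.+1 => g i) (Ordinal (iN : (i < N.+1)%N)).
Qed.

Lemma nat_seq_min (u : nat -> nat) : exists i, forall j, (u i <= u j)%N.
Proof.
have ex : exists n, `[< exists i, u i = n >] by exists (u 0%N); apply: asboolT; exists 0%N.
have [_ /asboolW[i <-] h] := ex_minnP ex.
by exists i => j; apply: h; apply: asboolT; exists j.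
Qed.

(** Minimising over the head gives an antitone function of the tail, which by induction sees only
    truncated tails. On the finite box of these the minimum is reached by a common head [i0]; larger
    heads give the minimum too, and the finitely many smaller heads are settled by induction. *)
Lemma noninc_box d l : noninc d l ->
  exists N, forall s, size s = d -> l s = l (map (minn N) s).
Proof.
elim: d l => [|d IHd] l hl; first by exists 0%N => -[].
have /choice[I hI] : forall s, exists i, forall j, (l (i :: s) <= l (j :: s))%N.
  by move=> s; apply: (nat_seq_min (fun i => l (i :: s))).
pose li s := l (I s :: s).
have hli : noninc d li.
  move=> s t ss st hst; rewrite /li.
  apply: leq_trans (hI t (I s)) _; exact: (noninc_cons (I s) hl).
have [N hN] := IHd _ hli.
have [i0 hi0] := box_bounded d N I.
have hmin s : size s = d -> size (map (minn N) s) = d by rewrite size_map.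
have tail s i : size s = d -> (i0 <= i)%N -> l (i :: s) = li s.
  move=> ss hi; apply/eqP; rewrite eqn_leq {2}/li hI andbT.
  rewrite hN //; set t := map _ s.
  have st : size t = d by apply: hmin.
  have le1 : (l (i :: s) <= l (i :: t))%N.
    apply: (noninc_cons i hl) => // j; case: (ltnP j d) => hj.
      by rewrite (nth_map 0%N) ?ss // geq_minr.
    by rewrite nth_default ?st.
  apply: leq_trans le1 _; apply: (noninc_head hl) => //.
  apply: leq_trans hi; apply: hi0 => //.
  by apply/allP => _ /mapP[j _ ->]; rewrite geq_minl.
have /choice[M hM] : forall i, exists N, forall s, size s = d ->
   l (i :: s) = l (i :: map (minn N) s).
  by move=> i; apply: (IHd (fun s => l (i :: s))); apply: noninc_cons.
pose K := (i0 + N + \max_(i < i0.+1) M i)%N.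
have small i s : (i <= i0)%N -> size s = d -> l (i :: s) = l (i :: map (minn K) s).
  move=> hi ss.
  have hMK : (M i <= K)%N.
    have := @leq_bigmax _ (fun i : 'I_i0.+1 => M i) (Ordinal (hi : (i < i0.+1)%N)).
    by rewrite /K /=; lia.
  rewrite hM // [RHS]hM ?size_map // -map_comp; congr (l (_ :: _)).
  by apply: eq_map => j /=; rewrite minnA (minn_idPl hMK).
exists K => -[//|i s] [ss] /=.
have iK0 : (i0 <= K)%N by rewrite /K -addnA leq_addr.
have sm : size (map (minn K) s) = d by rewrite size_map.
case: (leqP i i0) => hi.
  by rewrite (minn_idPr (leq_trans hi iK0)); apply: small.
have hK : (i0 <= minn K i)%N by rewrite leq_min iK0 ltnW.
rewrite (tail s i ss (ltnW hi)) -(tail s i0 ss (leqnn _)) (small i0 s (leqnn _) ss).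
by rewrite (tail _ i0 sm (leqnn _)) (tail _ _ sm hK).
Qed.

Lemma noninc_stable d l : noninc d.+1 l -> exists i0, forall i s, (i0 <= i)%N ->
  size s = d -> l (i :: s) = l (i0 :: s).
Proof.
move=> /noninc_box[N hN]; exists N => i s hi ss.
rewrite hN /= ?ss // [RHS]hN /= ?ss //.
by rewrite (minn_idPl hi) minnn.
Qed.

(** The enumeration is lexicographically increasing; the filtration in [len_graded] relies on each
    prefix being an initial segment of that order. *)
Fixpoint expts (d n : nat) : seq (seq nat) :=
  if d is d'.+1 then flatten [seq [seq i :: s | s <- expts d' (n - i)%N] | i <- iota 0 n.+1]
  else if n == 0%N then [:: [::]] else [::].

Lemma exptsS d n : expts d.+1 n =
  flatten [seq [seq i :: s | s <- expts d (n - i)%N] | i <- iota 0 n.+1].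
Proof. by []. Qed.

Lemma mem_expts d n s : (s \in expts d n) = (size s == d) && (sumn s == n).
Proof.
elim: d n s => [|d IHd] n s.
  by case: n s => [|n] [|i s].
rewrite exptsS; apply/flatten_mapP/andP => [[i]|[]].
  rewrite mem_iota => /= hi /mapP[t]; rewrite IHd => /andP[/eqP st /eqP sn] -> /=.
  by rewrite st sn; split=> //; apply/eqP; lia.
case: s => [//|i s] hs /eqP hn; have {}hn : (i + sumn s = n)%N := hn.
exists i; first by rewrite mem_iota; lia.
by apply/mapP; exists s => //; rewrite IHd; apply/andP; split=> //; apply/eqP; lia.
Qed.

(** Grouping by the head exponent turns the sum into a convolution, and [noninc_stable] provides the
    stabilisation required by [epoly_conv]. *)
Lemma epoly_expts d l : noninc d l ->
  epoly d (fun n => \sum_(s <- expts d n) (l s)%:Z).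
Proof.
elim: d l => [|d IHd] l hl.
  by exists 1%N => -[//|n] _; rewrite /= big_nil.
have [i0 hi0] := noninc_stable hl.
pose h i n := \sum_(s <- expts d n) (l (i :: s))%:Z.
apply: epoly_ext (@epoly_conv d i0 h _ _); last 2 first.
- by move=> i; apply: (IHd (fun s => l (i :: s))); apply: noninc_cons.
- move=> i n hi; apply: eq_big_seq => s; rewrite mem_expts => /andP[/eqP ss _].
  by rewrite hi0.
exists 0%N => n _; rewrite exptsS big_flatten big_map.
rewrite -[iota 0 n.+1]/(index_iota 0 n.+1) big_mkord.
by apply: eq_bigr => i _; rewrite big_map.
Qed.

Fixpoint lexs (s t : seq nat) : bool :=
  match s, t with
  | a :: s', b :: t' => (a < b)%N || ((a == b) && lexs s' t')
  | _, _ => false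
  end.

Lemma lexs_asym s t : lexs s t -> ~~ lexs t s.
Proof.
elim: s t => [|a s IHs] [|b t] //=; case: (ltngtP a b) => //= _; exact: IHs.
Qed.

Lemma lexs_irr s : ~~ lexs s s.
Proof. by apply/negP => h; have := lexs_asym h; rewrite h. Qed.

Lemma lexsP d s t : size s = d -> size t = d ->
  lexs s t <-> exists k : 'I_d, (nth 0 s k < nth 0 t k)%N /\
    forall j : 'I_d, (j < k)%N -> nth 0 s j = nth 0 t j :> nat.
Proof.
elim: d s t => [|d IHd] [|a s] [|b t] //= => [_ _|[ss] [st]].
  by split=> // -[[]].
split.
  case/orP=> [ab|/andP[/eqP-> /(IHd _ _ ss st)[k [hk hj]]]].
    by exists ord0; split=> // j.
  by exists (lift ord0 k); split=> // -[[|j] hj'] //= hjk; apply: (hj (Ordinal (hj' : (j < d)%N))).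
case=> -[[|k] hk] /= [h1 h2]; first by rewrite h1.
have /= -> := h2 (Ordinal (ltn0Sn d)) isT; rewrite eqxx ltnn /=.
apply/(IHd _ _ ss st); exists (Ordinal (hk : (k < d)%N)); split=> // j hj.
have hj' : (j.+1 < d.+1)%N by rewrite ltnS.
exact: (h2 (Ordinal hj')).
Qed.

Lemma pairwise_expts d n : pairwise lexs (expts d n).
Proof.
elim: d n => [|d IHd] n; first by case: n.
rewrite exptsS; have : pairwise ltn (iota 0 n.+1).
  by rewrite -sorted_pairwise; [exact: iota_ltn_sorted|exact: ltn_trans].
elim: (iota 0 n.+1) => [//|i l IHl] /= /andP[/allP hi /IHl hl].
rewrite pairwise_cat hl andbT; apply/andP; split.
  apply/allrelP => s t /mapP[s' _ ->] /flatten_mapP[j /hi ij /mapP[t' _ ->]] /=.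
  by rewrite (ij : (i < j)%N).
rewrite pairwise_map; apply: sub_pairwise (IHd (n - i)%N) => s t /=.
by rewrite eqxx => ->; rewrite orbT.
Qed.

Lemma expts_prefix d n s1 s s2 : expts d n = s1 ++ s :: s2 ->
  forall t, (t \in s1) = (t \in expts d n) && lexs t s.
Proof.
move=> e t; have := pairwise_expts d n; rewrite e pairwise_cat /=.
move=> /and3P[/allrelP h1 _ /andP[/allP h2 _]].
rewrite mem_cat inE; case: (boolP (t \in s1)) => [ht|_] /=.
  by rewrite h1 // mem_head.
case: eqP => [->|_] /=; first by rewrite (negbTE (lexs_irr s)).
by case: (boolP (t \in s2)) => //= /h2 /lexs_asym /negbTE ->.
Qed.

End MonotoneSums.

(** * The Hilbert-Samuel polynomial *)

Section HilbertSamuel.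
Variables (A : comNzRingType) (m : set A).
Hypotheses (noethA : is_noetherian A) (localA : is_local_ring m).
Variable d : nat.
Implicit Types (I J K L : set A) (e f g : 'I_d -> nat).

Section Filtration.
Variable x : 'I_d -> A.
Hypothesis sx : sop m x.
Let Q := sp predT x.

Let iQ : is_ideal Q. Proof. exact: sp_ideal. Qed.

Lemma ideal_pow_finl n : finl setT (ideal_pow Q n).
Proof.
apply: (finl_rad noethA localA); first exact: ideal_pow_ideal.
move=> p mp; have [_ /(_ p mp)[k hk]] := sx.
by apply: (@rad_exp _ _ p k); exists n; apply: exp_ideal_pow.
Qed.

Definition exp_lt f e := exists k, (f k < e k)%N /\ forall j : 'I_d, (j < k)%N -> f j = e j.

Definition lower e : set A :=
  ideal_gen (ideal_pow Q (\sum_i e i).+1 `|`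
    [set mono x f | f in [set f | (\sum_i f i = \sum_i e i)%N /\ exp_lt f e]]).

(* Leading coefficients at x^e of the forms of degree |e|: ordering the monomials
   filters Q^n / Q^(n+1) with factors A / lead_ideal e, |e| = n. *)
Definition lead_ideal e : set A := quo (lower e) (mono x e).

Lemma lead_ideal_ideal e : is_ideal (lead_ideal e).
Proof. by apply: quo_ideal; apply: ideal_gen_ideal. Qed.

Lemma mono_ideal_pow e : ideal_pow Q (\sum_i e i)%N (mono x e).
Proof. by rewrite ideal_pow_mpow; apply: mpow_mono. Qed.

Lemma sub_lead_ideal e : Q `<=` lead_ideal e.
Proof.
move=> a Qa; rewrite /lead_ideal /quo /=; apply: sub_ideal_gen; left.
rewrite mulrC; apply: sub_ideal_gen; exists a => //.
by exists (mono x e) => //; apply: mono_ideal_pow.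
Qed.

Lemma lead_ideal_finl e : finl setT (lead_ideal e).
Proof.
apply: (sop_finl noethA localA sx (lead_ideal_ideal e)); exact: sub_lead_ideal.
Qed.

(** Multiplication by [x^(f - e)] respects the lexicographic comparison of exponents, so it maps
    [lower e] into [lower f]. This is what makes [lead_len] antitone. *)
Lemma lead_ideal_mono e f : (forall i, e i <= f i)%N -> lead_ideal e `<=` lead_ideal f.
Proof.
move=> ef; pose g i := (f i - e i)%N.
have fE : f = (fun i => e i + g i)%N.
  by apply/funext => i; rewrite /g subnKC.
have sf : (\sum_i f i = \sum_i e i + \sum_i g i)%N by rewrite fE big_split.
have ilf : is_ideal (lower f) by apply: ideal_gen_ideal.
suff h : lower e `<=` quo (lower f) (mono x g).
  have mf : mono x f = mono x e * mono x g by rewrite [in LHS]fE monoD.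
  move=> a /h; rewrite /lead_ideal /quo /= mf => h2.
  by apply: (ideal_congr h2); ring.
apply: ideal_gen_sub => [|z [hz|[h [sh [k [hk hj]]] <-]]]; first exact: quo_ideal.
  rewrite /quo /=; apply: sub_ideal_gen; left.
  move: z hz.
  suff : ideal_pow Q (\sum_i e i).+1 `<=`
      quo (ideal_pow Q (\sum_i f i).+1) (mono x g) by [].
  rewrite ideal_pow_mpow; apply: ideal_gen_sub.
    by apply: quo_ideal; apply: ideal_pow_ideal.
  move=> _ [h /= sh <-].
  suff : ideal_pow Q (\sum_i f i).+1 (mono x g * mono x h) by [].
  rewrite -monoD ideal_pow_mpow.
  apply: sub_ideal_gen; exists (fun i => g i + h i)%N => //.
  by rewrite /= big_split /= sh sf addnS addnC.
rewrite /quo /= -monoD; apply: sub_ideal_gen; right.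
exists (fun i => g i + h i)%N => //; split; first by rewrite big_split /= sh sf addnC.
exists k; split; first by rewrite fE; lia.
by move=> j /hj; rewrite fE => ->; rewrite addnC.
Qed.

Definition lead_len (s : seq nat) : nat := len setT (lead_ideal (fun i => nth 0%N s i)).

Lemma lead_len_noninc : noninc d lead_len.
Proof.
move=> s t _ _ st; apply: len_sub => //; try exact: lead_ideal_ideal.
- by apply: lead_ideal_mono => i; apply: st.
- exact: lead_ideal_finl.
Qed.

Lemma sum_nth s : size s = d -> (\sum_(i < d) nth 0 s i = sumn s)%N.
Proof. by move=> <-; rewrite sumnE (big_nth 0%N) big_mkord. Qed.

Definition exp_seq e := [seq e i | i <- enum 'I_d].

Lemma size_exp_seq e : size (exp_seq e) = d.
Proof. by rewrite size_map size_enum_ord. Qed.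

Lemma nth_exp_seq e (i : 'I_d) : nth 0%N (exp_seq e) i = e i.
Proof. by rewrite (nth_map i) ?size_enum_ord // nth_ord_enum. Qed.

Lemma exp_seqK e : (fun i : 'I_d => nth 0%N (exp_seq e) i) = e.
Proof. by apply/funext => i; rewrite nth_exp_seq. Qed.

Lemma sumn_exp_seq e : sumn (exp_seq e) = (\sum_i e i)%N.
Proof.
by rewrite -sum_nth ?size_exp_seq //; apply: eq_bigr => i _; rewrite nth_exp_seq.
Qed.

Lemma len_graded n : len (ideal_pow Q n) (ideal_pow Q n.+1) =
  (\sum_(s <- expts d n) lead_len s)%N.
Proof.
pose X (s : seq nat) := mono x (fun i => nth 0%N s i).
pose B := ideal_pow Q n.+1.
pose AL (r : seq (seq nat)) := ideal_gen (B `|` [set X s | s in [set s | s \in r]]).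
have iB : is_ideal B by apply: ideal_pow_ideal.
have iAL r : is_ideal (AL r) by apply: ideal_gen_ideal.
have BAL r : B `<=` AL r by move=> z Bz; apply: sub_ideal_gen; left.
have fB : finl setT B by apply: ideal_pow_finl.
have prefix r1 : forall r2, expts d n = r1 ++ r2 ->
    len (AL r1) B = (\sum_(s <- r1) lead_len s)%N.
  elim/last_ind: r1 => [|r1 s IH] r2 er.
    have -> : AL [::] = B.
      apply/seteqP; split=> //; apply: ideal_gen_sub => // z [//|[s]].
      by rewrite /= in_nil.
    by rewrite big_nil len_self.
  have hs : s \in expts d n by rewrite er mem_cat mem_rcons mem_head.
  move: (hs); rewrite mem_expts => /andP[/eqP ss /eqP sn].
  rewrite cat_rcons in er; have pre := expts_prefix er.
  have ALr : AL (rcons r1 s) = adj (X s) (AL r1).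
    apply/seteqP; split.
      apply: ideal_gen_sub => [|z [/BAL h|[t /=]]]; first exact: adj_ideal.
        exact: sub_adj.
      rewrite mem_rcons inE => /predU1P[-> <-|ht <-]; first exact: adj_id.
      by apply: sub_adj; apply: sub_ideal_gen; right; exists t.
    apply: adj_sub => //.
      by apply: sub_ideal_gen; right; exists s => //=; rewrite mem_rcons mem_head.
    apply: ideal_gen_sub => // z [/BAL //|[t /= ht <-]].
    by apply: sub_ideal_gen; right; exists t => //=; rewrite mem_rcons inE ht orbT.
  (* By [expts_prefix] the monomials before [s] are exactly the smaller ones of the same degree, so
     adjoining [X s] adds a cyclic factor [A / lead_ideal]. *)
  have lowE : AL r1 = lower (fun i => nth 0%N s i).
    apply/seteqP; split; apply: ideal_gen_sub => //; try exact: ideal_gen_ideal.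
      move=> z [hz|[t /= ht <-]]; apply: sub_ideal_gen; [left|right].
        by rewrite sum_nth // sn.
      move: ht; rewrite pre mem_expts => /andP[/andP[/eqP st /eqP tn] /(lexsP st ss)[k [h1 h2]]].
      exists (fun i : 'I_d => nth 0%N t i) => //; split; first by rewrite !sum_nth // tn.
      by exists k; split.
    move=> z [hz|[f [sf [k [h1 h2]]] <-]]; apply: sub_ideal_gen; [left|right].
      by move: hz; rewrite sum_nth // sn.
    exists (exp_seq f); last by rewrite /X exp_seqK.
    rewrite /= pre mem_expts size_exp_seq sumn_exp_seq sf sum_nth // sn !eqxx /=.
    apply/(lexsP (size_exp_seq f) ss); exists k; rewrite nth_exp_seq; split=> // j.
    by rewrite nth_exp_seq; apply: h2.
  have ff : finl (AL (rcons r1 s)) B by apply: finlS fB.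
  have sAL : AL r1 `<=` AL (rcons r1 s) by rewrite ALr; apply: sub_adj.
  rewrite (len_add iB (iAL r1) (iAL _) (BAL _) sAL ff) (IH (s :: r2)) //.
  rewrite ALr len_cyclic //; last by rewrite -ALr; apply: finlS fB.
  by rewrite -cats1 big_cat big_seq1 addnC /lead_len /lead_ideal -lowE.
rewrite -(prefix _ [::]) ?cats0 //; congr (len _ _).
apply/seteqP; split; last first.
  apply: ideal_gen_sub; first exact: ideal_pow_ideal.
  move=> z [|[s /= hs <-]]; first exact: ideal_powS.
  move: hs; rewrite mem_expts => /andP[/eqP ss /eqP <-]; rewrite -sum_nth //.
  exact: mono_ideal_pow.
rewrite ideal_pow_mpow; apply: ideal_gen_sub => // _ [e /= se <-].
apply: sub_ideal_gen; right; exists (exp_seq e); last by rewrite /X exp_seqK.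
by rewrite /= mem_expts size_exp_seq sumn_exp_seq se !eqxx.
Qed.

Lemma epoly_len : epoly d.+1 (fun n => (len setT (ideal_pow Q n.+1))%:Z).
Proof.
apply: epoly_ext (epoly_sum (epoly_expts lead_len_noninc)); exists 0%N => n _.
elim: n => [|n IHn].
  rewrite big_ord1 -(big_morph Posz PoszD (erefl _)) -len_graded.
  by congr (Posz (len _ _)).
rewrite big_ord_recr IHn /= -(big_morph Posz PoszD (erefl _)) -len_graded -PoszD.
congr Posz; rewrite (len_add _ _ (@is_idealT A) (ideal_powS (n := n.+1) iQ)) //.
- exact: ideal_pow_ideal.
- exact: ideal_pow_ideal.
- exact: ideal_pow_finl.
Qed.

Lemma hilbert_coef_ex : exists c : 'I_d.+1 -> int, is_hilbert_coef Q c.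
Proof.
have [c [n0 h]] := epoly_coefs epoly_len.
exists c, n0 => n hn; rewrite quot_length_finl //; last exact: ideal_pow_finl.
  by rewrite h.
exact: ideal_pow_ideal.
Qed.

(** The existence of Hilbert coefficients ensures that [xget] does not fall back on its default. *)
Lemma multiplicity_coef : exists c : 'I_d.+1 -> int,
  is_hilbert_coef Q c /\ multiplicity d Q = c ord0.
Proof.
have [c hc] := hilbert_coef_ex.
pose P := [set e : int | exists c : 'I_d.+1 -> int, is_hilbert_coef Q c /\ e = c ord0].
have : P (xget 0 P) by apply: xgetPex; exists (c ord0), c.
by [].
Qed.

End Filtration.
End HilbertSamuel.

(** * Multiplicities *)

Section LeadingTerm.
Implicit Types (f g : nat -> int).

(* f(n) = O(n^(d-1)), multiplied by n to make sense for d = 0 *)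
Definition small d f := exists (C n0 : nat), forall n, (n0 <= n)%N ->
  `|f n| * n%:Z <= C%:Z * n%:Z ^+ d.

Lemma small_ext d f g : (exists n0, forall n, (n0 <= n)%N -> f n = g n) ->
  small d f -> small d g.
Proof.
move=> [n0 fg] [C [n1 h]]; exists C, (n0 + n1)%N => n hn.
by rewrite -fg ?h //; lia.
Qed.

Lemma smallD d f g : small d f -> small d g -> small d (fun n => f n + g n).
Proof.
move=> [C [n0 h]] [D [n1 k]]; exists (C + D)%N, (n0 + n1)%N => n hn.
have hn0 : (n0 <= n)%N by lia.
have hn1 : (n1 <= n)%N by lia.
rewrite PoszD mulrDl; apply: le_trans (lerD (h n hn0) (k n hn1)).
by rewrite -mulrDl ler_wpM2r // ler_normD.
Qed.

Lemma smallZ d f (a : int) : small d f -> small d (fun n => a * f n).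
Proof.
move=> [C [n0 h]]; exists (`|a| * C)%N, n0 => n hn.
by rewrite normrM PoszM abszE -!mulrA ler_wpM2l // h.
Qed.

Lemma small_mul d f a : small d f -> small d.+1 (fun n => (n%:Z + a%:Z) * f n).
Proof.
move=> [C [n0 h]]; exists ((1 + a) * C)%N, n0.+1 => n hn.
have hn' : (n0 <= n)%N by lia.
rewrite normrM -mulrA.
have le1 : `|n%:Z + a%:Z| <= (1 + a)%:Z * n%:Z by nia.
have nn : 0 <= n%:Z by [].
have := ler_pM (normr_ge0 _) (mulr_ge0 (normr_ge0 _) nn) le1 (h n hn').
by rewrite mulrACA -PoszM -exprS.
Qed.

Lemma smallS d f : small d f -> small d.+1 f.
Proof.
move=> [C [n0 h]]; exists C, n0.+1 => n hn.
apply: le_trans (h n _) _; first by lia.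
by rewrite ler_wpM2l // exprS ler_peMl ?exprn_ge0 //; lia.
Qed.

Lemma small_le d e f : (d <= e)%N -> small d f -> small e f.
Proof.
move=> le_de hf; rewrite -(subnK le_de); elim: (e - d)%N => [//|k IHk].
by rewrite addSn; apply: smallS.
Qed.

Lemma small_exp d : small d.+1 (fun n => n%:Z ^+ d).
Proof.
exists 1%N, 0%N => n _.
by rewrite mul1r exprSr ger0_norm ?exprn_ge0.
Qed.

Lemma small0 d : small d (fun=> 0).
Proof. by exists 0%N, 0%N => n _; rewrite normr0 !mul0r. Qed.

Lemma small_absorb d f g : (exists n0, forall n, (n0 <= n)%N -> `|f n| <= `|g n|) ->
  small d g -> small d f.
Proof.
move=> [n0 fg] [C [n1 h]]; exists C, (n0 + n1)%N => n hn.
apply: le_trans (h n _); last by lia.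
by rewrite ler_wpM2r // fg //; lia.
Qed.

Lemma small_bin j : small j (fun n => (j`!)%:Z * ('C(n + j, j))%:Z - n%:Z ^+ j).
Proof.
elim: j => [|j IHj].
  by apply: small_ext (small0 0); exists 0%N => n _; rewrite bin0 fact0 expr0; ring.
have h := smallD (small_mul j.+1 IHj) (smallZ j.+1%:Z (small_exp j)).
apply: small_ext h; exists 0%N => n _.
have e : j.+1%:Z * ('C(n + j.+1, j.+1))%:Z = (n%:Z + j.+1%:Z) * ('C(n + j, j))%:Z.
  by rewrite -PoszD -!PoszM addnS mul_bin_diag.
have fS : ((j.+1)`!)%:Z = (j`!)%:Z * j.+1%:Z by rewrite factS mulnC PoszM.
rewrite [((j.+1)`!)%:Z]fS -[in RHS]mulrA e exprS; ring.
Qed.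

Lemma small_binlt j d : (j < d)%N -> small d (fun n => ('C(n + j, j))%:Z).
Proof.
move=> jd; have h1 := small_le (ltnW jd) (small_bin j).
have h2 := small_le jd (small_exp j).
apply: (small_absorb _ (smallD h1 h2)); exists 0%N => n _.
rewrite subrK normrM ler_peMl //.
by rewrite ger0_norm //; have := fact_gt0 j; lia.
Qed.

Lemma small_affine d k r f : (0 < k)%N -> small d f -> small d (fun n => f (k * n + r)%N).
Proof.
move=> k0 [C [n0 h]]; exists (C * (k + r) ^ d)%N, n0.+1 => n hn.
have hn' : (n0 <= k * n + r)%N by nia.
apply: le_trans (le_trans (h _ hn') _).
  by rewrite ler_wpM2l //; nia.
rewrite PoszM -mulrA ler_wpM2l //.
have -> : ((k + r) ^ d)%N%:Z = (k + r)%N%:Z ^+ d.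
  by elim: d {h} => // d IHd; rewrite expnS PoszM IHd exprS.
by rewrite -exprMn lerXn2r ?nnegrE //; nia.
Qed.

Lemma small_affine_exp d (k r : nat) :
  small d (fun n => (k * n + r)%N%:Z ^+ d - k%:Z ^+ d * n%:Z ^+ d).
Proof.
elim: d => [|d IHd].
  by apply: small_ext (small0 0); exists 0%N => n _; rewrite !expr0; ring.
have h1 := smallZ k%:Z (small_mul 0 IHd).
have h2 := smallZ r%:Z (smallS IHd).
have h3 := smallZ (r%:Z * k%:Z ^+ d) (small_exp d).
apply: small_ext (smallD h1 (smallD h2 h3)); exists 0%N => n _.
by rewrite !exprS PoszD PoszM; ring.
Qed.

Lemma small_sum d k (f : 'I_k -> nat -> int) : (forall i, small d (f i)) ->
  small d (fun n => \sum_i f i n).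
Proof.
elim: k f => [|k IHk] f hf.
  by apply: small_ext (small0 d); exists 0%N => n _; rewrite big_ord0.
apply: small_ext (smallD (hf ord0) (IHk (fun i => f (lift ord0 i)) (fun i => hf _))).
by exists 0%N => n _; rewrite big_ord_recl.
Qed.

Lemma small_hilbert d (c : 'I_d.+1 -> int) f :
  (exists n0, forall n, (n0 <= n)%N ->
    f n = \sum_(i < d.+1) (-1) ^+ i * c i * ('C(n + (d - i), d - i))%:Z) ->
  small d (fun n => (d`!)%:Z * f n - c ord0 * n%:Z ^+ d).
Proof.
move=> [n0 hf].
have h1 := smallZ (c ord0) (small_bin d).
pose t (i : 'I_d) n := (d`!)%:Z * (-1) ^+ (lift ord0 i) * c (lift ord0 i) *
  ('C(n + (d - lift ord0 i), d - lift ord0 i))%:Z.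
have h2 : small d (fun n => \sum_i t i n).
  apply: small_sum => i; apply: smallZ; apply: small_binlt.
  by rewrite lift0; have := ltn_ord i; lia.
apply: small_ext (smallD h1 h2); exists n0 => n hn.
rewrite hf // [in RHS]big_ord_recl expr0 subn0 [in RHS]mulrDr [in RHS]mulr_sumr.
have -> : \sum_i t i n = \sum_(i < d) (d`!)%:Z * ((-1) ^+ lift ord0 i * c (lift ord0 i) *
   ('C(n + (d - lift ord0 i), d - lift ord0 i))%:Z).
  by apply: eq_bigr => i _; rewrite /t !mulrA.
by ring.
Qed.

(** If [a > b], integrality gives [n^d <= |f n| + |g n|], while the right side times [n] is at most
    [(C + D) n^d] for large [n]; the chosen [n] exceeds [C + D]. *)
Lemma small_squeeze d f g (a b : int) : small d f -> small d g ->
  (forall n, a * n%:Z ^+ d + f n <= b * n%:Z ^+ d + g n) -> a <= b.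
Proof.
move=> [C [n0 hf]] [D [n1 hg]] le; rewrite leNgt; apply/negP => ba.
pose n := (n0 + n1 + C + D).+1.
have hn : `|f n| * n%:Z <= C%:Z * n%:Z ^+ d by apply: hf; rewrite /n; lia.
have kn : `|g n| * n%:Z <= D%:Z * n%:Z ^+ d by apply: hg; rewrite /n; lia.
have pn : 0 < n%:Z ^+ d :> int by apply: exprn_gt0.
have h1 : n%:Z ^+ d <= `|f n| + `|g n| by have := le n; nia.
have h2 : n%:Z ^+ d * n%:Z <= (C%:Z + D%:Z) * n%:Z ^+ d by nia.
have : n%:Z <= C%:Z + D%:Z by rewrite -(ler_pM2l pn) (mulrC _ (C%:Z + D%:Z)).
by rewrite /n; lia.
Qed.

End LeadingTerm.

(** * Multiplicities of powers of parameters, and the Buchsbaum condition *)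

Section Multiplicity.
Variables (A : comNzRingType) (m : set A).
Hypotheses (noethA : is_noetherian A) (localA : is_local_ring m).
Variable d : nat.
Implicit Types (w : 'I_d -> A).

Lemma hilbert_small w (c : 'I_d.+1 -> int) : sop m w ->
  is_hilbert_coef (sp predT w) c -> forall k r, (0 < k)%N -> small d (fun n =>
    (d`!)%:Z * (len setT (ideal_pow (sp predT w) (k * n + r).+1))%:Z
      - (k%:Z ^+ d * c ord0) * n%:Z ^+ d).
Proof.
move=> sw [n0 hc] k r k0.
pose F n := (len setT (ideal_pow (sp predT w) n.+1))%:Z.
have hF : small d (fun n => (d`!)%:Z * F n - c ord0 * n%:Z ^+ d).
  apply: small_hilbert; exists n0 => n /hc.
  rewrite quot_length_finl => [[<-]//|||].
  - exact: ideal_pow_ideal.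
  - by [].
  - exact: (ideal_pow_finl noethA localA sw).
have h1 := small_affine r k0 hF.
have h2 := smallZ (c ord0) (small_affine_exp d k r).
by apply: small_ext (smallD h1 h2); exists 0%N => n _; rewrite /F; ring.
Qed.

(** A sandwich for [Q = (w)]: [Q^(k(n+1) + d(k-1))] lies in [(w^k)^(n+1)], which lies in
    [Q^(k(n+1))]. The two offsets [r] passed to [hk] write these exponents as [k n + r + 1], and
    leading terms are compared. *)
Lemma multiplicity_pow w k : sop m w -> (0 < k)%N ->
  multiplicity d (sp predT (fun i => w i ^+ k)) = k%:Z ^+ d * multiplicity d (sp predT w).
Proof.
move=> sw k0; have swk := sop_pow localA sw k0.
have [c [hc ->]] := multiplicity_coef noethA localA sw.
have [e [he ->]] := multiplicity_coef noethA localA swk.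
have hk r := hilbert_small sw hc (k := k) r k0.
have h1 := hilbert_small swk he (k := 1) 0 isT.
have E (a b : int) : a + (b - a) = b by ring.
have dpos : 0 <= (d`!)%:Z by [].
apply/eqP; rewrite eq_le; apply/andP; split.
- apply: small_squeeze h1 (hk (k.-1 + d * k.-1)%N) _ => n; rewrite expr1n mul1r !E.
  rewrite ler_wpM2l // lez_nat; apply: len_sub => //; try exact: ideal_pow_ideal.
    by apply: ideal_pow_exp => //; rewrite mul1n addn0; nia.
  exact: (ideal_pow_finl noethA localA sw).
- apply: small_squeeze (hk k.-1) h1 _ => n; rewrite expr1n mul1r !E.
  rewrite ler_wpM2l // lez_nat; apply: len_sub => //; try exact: ideal_pow_ideal.
    have -> : (k * n + k.-1).+1 = (k * (1 * n + 0).+1)%N by nia.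
    exact: ideal_pow_expn.
  exact: (ideal_pow_finl noethA localA swk).
Qed.

Hypothesis d_ge1 : (1 <= d)%N.
Hypothesis buchsbaumA : is_buchsbaum m d.

Let e w := multiplicity d (sp predT w).
Let L w := len setT (sp predT w).

Lemma buchsbaum_len w w' : sop m w -> sop m w' -> (L w)%:Z - e w = (L w')%:Z - e w'.
Proof.
have par (v : 'I_d -> A) : sop m v -> is_parameter_ideal m d (sp predT v).
  by move=> sv; exists v; split; [apply/is_sopE|rewrite ideal_gen_range].
have fin (v : 'I_d -> A) : sop m v -> quot_length setT (sp predT v) = (L v)%:Z%:E.
  move=> sv; apply: quot_length_finl => //; first exact: sp_ideal.
  by apply: (sop_finl noethA localA sv) => //; apply: sp_ideal.
move=> sw sw'; have := buchsbaumA (par w sw) (par w' sw').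
by rewrite !fin // -!EFinB => -[].
Qed.

(** In the filtration of [A] by the [(x^j) + J], each of the [k] successive quotients is an image of
    [A / ((x) + J)] under multiplication by [x^j]. *)
Lemma len_upd_exp w i k : sop m w -> (L (upd w i (w i ^+ k)) <= k * L w)%N.
Proof.
move=> sw; rewrite /L sp_updT (sp_adjT w i).
set x := w i; set J := sp _ _.
have iJ : is_ideal J by apply: sp_ideal.
have iQ n : is_ideal (adj (x ^+ n) J) by apply: adj_ideal.
have fQ n : finl setT (adj (x ^+ n) J).
  case: n => [|n].
    exists 0%N => n [K [hK Klt]]; rewrite leqNgt; apply/negP => n0.
    have [_ h] := Klt 0%N n0; apply: h => z _.
    have [_ + _] := hK 0%N isT; apply.
    by exists z => //; apply: (ideal_congr (ideal0 iJ)); ring.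
  apply: (sop_finl noethA localA (sop_upd_pow localA i sw (ltn0Sn n))) => //.
  by rewrite sp_updT.
elim: k => [|k IHk].
  rewrite mul0n leqn0; apply/eqP.
  have -> : adj (x ^+ 0) J = setT.
    apply/seteqP; split=> // z _; exists z => //.
    by apply: (ideal_congr (ideal0 iJ)); ring.
  by apply: len_self; apply: is_idealT.
have QQ : adj (x ^+ k.+1) J `<=` adj (x ^+ k) J.
  apply: adj_sub => //; last exact: sub_adj.
  by rewrite exprSr; apply: adj_mul.
rewrite (len_add (iQ k.+1) (iQ k) (@is_idealT A) QQ (@subsetT _ _) (fQ k.+1)) mulSn addnC.
apply: leq_add => //.
apply: len_chn_le => //; first exact: adj_ideal.
  by apply: (sop_finl noethA localA sw); [apply: adj_ideal|rewrite (sp_adjT w i)].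
move=> n; apply: (has_chain_mul_surj (x := x ^+ k) (@is_idealT A)) => //.
  move=> a [b _ h]; exists b => //.
  by apply: (ideal_congr (idealM (x ^+ k) iJ h)); rewrite exprSr; ring.
by apply: linS => //; apply: sub_adj.
Qed.

(* The inequality holds up to a constant by subadditivity of the length and
   constancy of L - e; replacing w by w^N and dividing by N^d removes the constant. *)
Lemma multiplicity_upd_le w i k : sop m w -> (0 < k)%N ->
  e (upd w i (w i ^+ k)) <= k%:Z * e w.
Proof.
move=> sw k0; set v := upd w i _.
have sv : sop m v by apply: sop_upd_pow.
rewrite leNgt; apply/negP => lt.
pose I := (L w)%:Z - e w.
have key N : (0 < N)%N -> N%:Z ^+ d * (e v - k%:Z * e w) <= (k%:Z - 1) * I.
  move=> N0; pose wN j := w j ^+ N; pose vN j := v j ^+ N.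
  have swN : sop m wN by apply: sop_pow.
  have svN : sop m vN by apply: sop_pow.
  have evN : vN = upd wN i (wN i ^+ k).
    apply/funext => j; rewrite /vN /v /upd /wN.
    by case: eqP => // _; rewrite -!exprM mulnC.
  have := len_upd_exp i k swN; rewrite -evN.
  have := buchsbaum_len svN sw; have := buchsbaum_len swN sw.
  have -> : e wN = N%:Z ^+ d * e w by apply: multiplicity_pow.
  have -> : e vN = N%:Z ^+ d * e v by apply: multiplicity_pow.
  rewrite -/I -lez_nat PoszM; set D := N%:Z ^+ d => h1 h2 h3.
  have E1 : (L wN)%:Z = D * e w + I by rewrite -h1; ring.
  have E2 : (L vN)%:Z = D * e v + I by rewrite -h2; ring.
  rewrite E1 E2 in h3; rewrite -subr_ge0; rewrite -subr_ge0 in h3.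
  by apply: (le_trans h3); rewrite le_eqVlt; apply/orP; left; apply/eqP; ring.
(* At [N = B + 1] the inequality [key] fails: [e v - k e w] is at least 1, and [N <= N^d] because
   [d >= 1]. *)
pose B := `|((k%:Z - 1) * I)%R|%N.
have := key B.+1 isT.
have : B.+1%:Z <= B.+1%:Z ^+ d.
  by apply: ler_eXnr => //; rewrite /B; lia.
by rewrite /B => h1 h2; nia.
Qed.

(* Applied to all variables, multiplicity_upd_le bounds e (w^k) by k^d e w, which
   is its value by multiplicity_pow; so each inequality is an equality. *)
Lemma multiplicity_upd w i k : sop m w -> (0 < k)%N ->
  e (upd w i (w i ^+ k)) = k%:Z * e w.
Proof.
move=> sw k0; apply/eqP; rewrite eq_le multiplicity_upd_le //=.
pose g (r : seq 'I_d) j := w j ^+ (if j \in i :: r then k else 1%N).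
have sg r : sop m (g r).
  apply: (sop_trans sw) => j.
    have -> : g r j = w j ^+ (if j \in i :: r then k else 1%N).-1.+1.
      by rewrite prednK //; case: ifP.
    rewrite exprS; apply: idealMr; first exact: max_ideal localA.
    by case: sw.
  by exists (if j \in i :: r then k else 1%N); rewrite -/(g r j); apply: sp_mem.
have gu r j : j \notin i :: r -> g (j :: r) = upd (g r) j (g r j ^+ k).
  move=> hj; apply/funext => l; rewrite /upd /g; case: eqP => [->|/eqP lj].
    by rewrite (negPf hj) !inE eqxx orbT expr1.
  by rewrite !inE (negPf lj).
have step (r : seq 'I_d) : uniq (i :: r) -> e (g r) <= k%:Z ^+ size r * e (g [::]).
  elim: r => [|j r IHr]; first by rewrite expr0 mul1r.
  rewrite /= inE negb_or => /andP[/andP[ij ir] /andP[jr ur]].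
  rewrite gu; last by rewrite inE negb_or eq_sym ij.
  apply: le_trans (multiplicity_upd_le j (sg r) k0) _.
  by rewrite exprS -mulrA ler_wpM2l // IHr //= ir.
(* Raising the other [d - 1] entries as well yields [w^k], so [k^d e w <= k^(d-1) e (upd w i (w i ^+
   k))]; the factor [k^(d-1)] cancels. *)
have := step (enum (predC1 i)).
have -> : uniq (i :: enum (predC1 i)) by rewrite /= enum_uniq mem_enum /= inE eqxx.
have -> : g (enum (predC1 i)) = (fun j => w j ^+ k).
  by apply/funext => j; rewrite /g inE mem_enum inE orbN.
have -> : g [::] = upd w i (w i ^+ k).
  apply/funext => j; rewrite /g /upd inE; case: eqP => [->//|_].
  by rewrite expr1.
move/(_ isT); rewrite {1}/e multiplicity_pow //.
have -> : size (enum (predC1 i)) = d.-1 by rewrite -cardE cardC1 card_ord.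
rewrite -{1}(prednK d_ge1) exprSr -mulrA ler_pM2l //.
by apply: exprn_gt0.
Qed.

Lemma buchsbaum_linear_len w : sop m w -> forall i, exists a c : int,
  forall n, (0 < n)%N -> (L (upd w i (w i ^+ n)))%:Z = n%:Z * a + c.
Proof.
move=> sw i; exists (e w), ((L w)%:Z - e w) => n n0.
have su : sop m (upd w i (w i ^+ n)) by apply: sop_upd_pow.
by rewrite -(multiplicity_upd i sw n0) -(buchsbaum_len su sw); ring.
Qed.

End Multiplicity.

Unset Implicit Arguments.

Theorem mainTheorem9 (A : comNzRingType) (m : set A) (d : nat)
  (noethA : is_noetherian A) (localA : is_local_ring m)
  (dimA : krull_dim A = (d%:Z)%:E) (d_ge1 : (1 <= d)%N)
  (buchsbaumA : is_buchsbaum m d) :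
  exists l : nat, forall Q : set A,
    is_parameter_ideal m d Q -> Q `<=` ideal_pow m l ->
    reducibility_index m Q = cm_type m d.
Proof.
(* Without a system of parameters there is no parameter ideal, and any [l] works. *)
have [[w sw]|nsop] := pselect (exists w : 'I_d -> A, sop m w); last first.
  by exists 0%N => Q [x [/(is_sopE noethA localA) sx _]]; case: nsop; exists x.
have linear := buchsbaum_linear_len noethA localA d_ge1 buchsbaumA.
have weak v (P : pred 'I_d) i n c := @sp_colon A m noethA localA d linear v P i n c.
have conn := sop_connected noethA localA linear.
pose y k := w k ^+ 2; have sy : sop m y by apply: sop_pow.
pose r (v : 'I_d -> A) := len (ideal_colon (sp predT v) m) (sp predT v).
have rE v : sop m v -> reducibility_index m (sp predT v) = (r v)%:Z%:E.
  move=> sv; have iv := sp_ideal predT v.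
  apply: quot_length_finl => //; first exact: sub_colon.
  by apply: finlS (sop_finl noethA localA sv iv _).
have r_max v : sop m v -> (r v <= r y)%N.
  exact: (reducibility_max noethA localA weak conn sw).
have typeE : cm_type m d = (r y)%:Z%:E.
  rewrite /cm_type; set S := (X in supremum _ X).
  have Sy : S (r y)%:Z%:E.
    exists (sp predT y); last exact: rE.
    by exists y; split; [apply/is_sopE|rewrite ideal_gen_range].
  have supS : supremums S (r y)%:Z%:E.
    split=> [_ [_ [v [/(is_sopE noethA localA) sv ->] <-]]|u]; last exact.
    by rewrite ideal_gen_range rE // lee_fin lez_nat; apply: r_max.
  rewrite /supremum; case: ifPn => [/eqP S0|_]; first by rewrite S0 in Sy.
  exact: is_subset1_supremums (xgetI _ supS) supS.
(* The exponent [l] is such that [m^l] lies in [(w^2)], where the maximum is attained; every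
   admissible [Q] is then inside [(w^2)]. *)
have [_ [l hl]] : is_sop m y by apply/is_sopE.
exists l => _ [z [/(is_sopE noethA localA) sz ->]]; rewrite typeE ideal_gen_range => zl.
rewrite rE //; congr (_%:E); congr Posz; apply/eqP; rewrite eqn_leq r_max //=.
apply: (reducibility_le noethA localA weak conn) => //.
by apply: subset_trans zl _; rewrite -(ideal_gen_range y).
Qed.
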